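(* In the sampling framework described in the context, suppose that, given $\{(X_i',D_i)'\}_{i\in\mathcal S}=\{(x_i',d_i)'\}_{i\in\mathcal S}$: (1) $\mathcal S^*\subseteq\mathcal S$, the covariate function $s$ and the conditional distribution $F$ are functions of $\{(X_i',D_i)'\}_{i\in\mathcal S}$; (2) $\lim_{|\mathcal S|\to\infty}|\mathcal S^*|=\infty$; (3) for some fixed constant $\underline\lambda>0$, $\liminf_{|\mathcal S|\to\infty}\lambda_{\min}[\Gamma^*]\ge\underline\lambda$; (4) for some fixed constant $\underline\lambda>0$, $\liminf_{|\mathcal S|\to\infty}\lambda_{\min}[\Delta^*]\ge\underline\lambda$; (5) for a fixed $\delta>0$ and each $d\in\{0,1\}$, $\mathbf E_F[\|ZU\|^{2+\delta}|X=\cdot,D=d]$ is bounded on $\mathbb X^{*d}$ by a fixed constant. Let $\Sigma^*=(\Gamma^* )^{-1}\Delta^*(\Gamma^* )^{-1}$. Then $\Sigma^{*-1/2}\sqrt{|\mathcal S^*|}(\hat\theta^*-\theta_{\mathbb G^*,F})$ converges in conditional distribution to $\mathcal N(\mathbf 0,I)$: $$\rho\Bigl(\mathcal L_{\Sigma^{*-1/2}\sqrt{|\mathcal S^*|}(\hat\theta^*-\theta_{\mathbb G^*,F})|\{(X_i',D_i)'\}_{i\in\mathcal S}},\ \mathcal N(\mathbf 0,I)\Bigr)\to0$$ given $\{(X_i',D_i)'\}_{i\in\mathcal S}=\{(x_i',d_i)'\}_{i\in\mathcal S}$, as $|\mathcal S|\to\infty$.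
   Context: For each sample size $|\mathcal S|$ there is a finite random sample $\mathcal S$ of units $i$ with $Y_i\in\mathbb R$, $X_i\in\mathbb R^p$, $D_i\in\{0,1\}$. $F$ is the conditional distribution of $Y$ given $(X',D)'$ (a kernel), which may depend on $\{(X_i',D_i)'\}_{i\in\mathcal S}$; conditionally on $\{(X_i',D_i)'\}_{i\in\mathcal S}$ the $Y_i$ are independent with $Y_i\sim F(\cdot|X_i,D_i)$ (a triangular array as $|\mathcal S|$ varies). The values $\{(x_i',d_i)'\}_{i\in\mathcal S}$ are fixed realizations; $\mathcal L_{\cdot|\{(X_i',D_i)'\}_{i\in\mathcal S}}$ is the conditional law and $\mathbf E_F$ refers to the randomness of $Y$ under $F$. ''Fixed constant'' means not depending on $|\mathcal S|$. $\mathcal S^*\subseteq\mathcal S$ is a subsample, $\mathcal S^{*d}=\{i\in\mathcal S^*:D_i=d\}$, $\mathbb X^{*d}=\{X_i:i\in\mathcal S^{*d}\}$, and $\mathbb G^*$ is the empirical distribution of $(X_i',D_i)'$ within $\mathcal S^*$. $s$ maps $\mathbb R^p$ to a Euclidean space of fixed dimension; $Z=(1,D,s(X)')'$, $Z_i=(1,D_i,s(X_i)')'$; $U=Y-\mathbf E_F[Y|X,D]$. Define $\Gamma^*=|\mathcal S^*|^{-1}\sum_{i\in\mathcal S^*}Z_iZ_i'$, $\Delta^*=|\mathcal S^*|^{-1}\sum_{i\in\mathcal S^*}Z_iZ_i'\,\mathbf E_F[U^2|X=X_i,D=D_i]$, $$\hat\theta^*=(\Gamma^* )^{-1}\frac1{|\mathcal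 S^*|}\sum_{i\in\mathcal S^*}Z_iY_i,\qquad \theta_{\mathbb G^*,F}=(\Gamma^* )^{-1}\frac1{|\mathcal S^*|}\sum_{i\in\mathcal S^*}Z_i\,\mathbf E_F[Y|X=X_i,D=D_i].$$ $\lambda_{\min}[A]$ is the smallest eigenvalue of a symmetric positive semi-definite matrix $A$. $\rho$ is the Lévy–Prokhorov metric: $\rho(P,Q)=\inf\{\varepsilon>0:P[A]\le Q[A^\varepsilon]+\varepsilon\ \text{for all Borel }A\}$, $A^\varepsilon$ being the $\varepsilon$-enlargement of $A$. *)

(* Defs.v *)
From HB Require Import structures.
From mathcomp Require Import all_boot all_order all_algebra.
From mathcomp Require Import all_classical all_reals all_analysis.

Set Implicit Arguments.
Unset Strict Implicit.
Unset Printing Implicit Defensive.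

Import Order.TTheory GRing.Theory Num.Theory.
Import numFieldNormedType.Exports.

Local Open Scope classical_set_scope.
Local Open Scope ring_scope.

(* A sample of size n is indexed by 'I_n. R^p is p.-tuple R, whose measurable
   sets, generated by the coordinates, are the Borel sets. A value of (X', D)'
   has type covariate R p, and a realization of all the covariates of a sample
   has type covariates R p n. *)
Notation covariate R p := (p.-tuple R * bool)%type.
Notation covariates R p n := (n.-tuple (covariate R p)).

Definition mutually_independent d (T : measurableType d) (R : realType)
    (P : set T -> \bar R) (n : nat) (Y : 'I_n -> T -> R) : Prop :=
  forall (J : {set 'I_n}) (B : 'I_n -> set R),
    (forall i, measurable (B i)) ->
    P (\bigcap_(i in [set` J]) (Y i @^-1` B i)) =
      (\prod_(i in J) P (Y i @^-1` B i))%E.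

(* sm_cond is the regular conditional probability given the covariates sm_XD;
   sm_F w is the conditional distribution F of Y given (X', D)', which may
   depend on the realization w of the covariates. *)
Record sampling_model (R : realType) (p n : nat) := SamplingModel {
  sm_disp : measure_display ;
  sm_space : measurableType sm_disp ;
  sm_prob : probability sm_space R ;
  sm_XD : {mfun sm_space >-> covariates R p n} ;
  sm_Y : 'I_n -> {mfun sm_space >-> R} ;
  sm_cond : R.-pker (covariates R p n) ~> sm_space ;
  sm_F : covariates R p n -> R.-pker (covariate R p) ~> R ;
  sm_disintegration :
    forall (A : set sm_space) (B : set (covariates R p n)),
    measurable A -> measurable B ->
    sm_prob (A `&` sm_XD @^-1` B) =
      (\int[distribution sm_prob sm_XD]_(w in B) sm_cond w A)%E ;
  sm_independent : forall w : covariates R p n,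
    mutually_independent (sm_cond w) (fun i => sm_Y i : sm_space -> R) ;
  sm_law : forall (w : covariates R p n) (i : 'I_n) (B : set R), measurable B ->
    sm_cond w (sm_Y i @^-1` B) = sm_F w (tnth w i) B
}.

Definition enorm (R : realType) (m : nat) (v : 'cV[R]_m) : R :=
  Num.sqrt (\sum_i v i 0 ^+ 2).

(* For a symmetric matrix of positive size the set of eigenvalues is finite and
   nonempty, so that the infimum is attained. *)
Definition lambda_min (R : realType) (m : nat) (A : 'M[R]_m) : R :=
  inf [set a | eigenvalue A a].

Definition psd (R : realType) (m : nat) (A : 'M[R]_m) : Prop :=
  A^T = A /\ forall v : 'cV[R]_m, 0 <= (v^T *m A *m v) 0 0.

(* The unique positive semi-definite square root of a positive semi-definite
   matrix (0 if the matrix has none). *)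
Definition sqrtmx (R : realType) (m : nat) (A : 'M[R]_m) : 'M[R]_m :=
  xget 0 [set B | psd B /\ B *m B = A].

Section conditional_moments.
Context (R : realType) (p k : nat).
Variables (F : R.-pker (covariate R p) ~> R) (s : p.-tuple R -> 'cV[R]_k).

Definition cond_mean (xd : covariate R p) : R := \int[F xd]_y y.

(* E_F[U^2 | (X', D)' = xd], where U = Y - E_F[Y | X, D] *)
Definition cond_var (xd : covariate R p) : R :=
  \int[F xd]_y (y - cond_mean xd) ^+ 2.

Definition regressor (xd : covariate R p) : 'cV[R]_(1 + (1 + k)) :=
  col_mx (const_mx 1) (col_mx (const_mx (xd.2)%:R) (s xd.1)).

(* E_F[ ||Z U||^q | (X', D)' = xd], possibly infinite *)
Definition cond_moment (q : R) (xd : covariate R p) : \bar R :=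
  (\int[F xd]_y (enorm ((y - cond_mean xd) *: regressor xd) `^ q)%:E)%E.

End conditional_moments.

Section regression.
Context (R : realType) (p k n : nat).
Variables (F : R.-pker (covariate R p) ~> R) (s : p.-tuple R -> 'cV[R]_k).
Variables (w : covariates R p n) (S : {set 'I_n}).

Local Notation Z i := (regressor s (tnth w i)).

Definition subsample_covariates (d : bool) : set (p.-tuple R) :=
  [set (tnth w i).1 | i in [set i | i \in S /\ (tnth w i).2 = d]].

Definition Gamma_mx : 'M[R]_(1 + (1 + k)) :=
  #|S|%:R^-1 *: \sum_(i in S) Z i *m (Z i)^T.

Definition Delta_mx : 'M[R]_(1 + (1 + k)) :=
  #|S|%:R^-1 *: \sum_(i in S) cond_var F (tnth w i) *: (Z i *m (Z i)^T).

Definition Sigma_mx : 'M[R]_(1 + (1 + k)) :=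
  invmx Gamma_mx *m Delta_mx *m invmx Gamma_mx.

Definition theta_hat (y : 'I_n -> R) : 'cV[R]_(1 + (1 + k)) :=
  invmx Gamma_mx *m (#|S|%:R^-1 *: \sum_(i in S) y i *: Z i).

Definition theta_target : 'cV[R]_(1 + (1 + k)) :=
  invmx Gamma_mx *m
    (#|S|%:R^-1 *: \sum_(i in S) cond_mean F (tnth w i) *: Z i).

Definition studentized (y : 'I_n -> R) : 'cV[R]_(1 + (1 + k)) :=
  invmx (sqrtmx Sigma_mx) *m
    (Num.sqrt #|S|%:R *: (theta_hat y - theta_target)).

End regression.

(* Conditional law, given that the covariates equal w, of a statistic T that is
   a function of the covariates and of the outcomes; w is substituted for the
   covariates in T, so that T only has to be a measurable function of the
   outcomes. *)
Definition cond_law (R : realType) (p n m : nat) (M : sampling_model R p n)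
    (w : covariates R p n) (T : covariates R p n -> ('I_n -> R) -> 'cV[R]_m) :
    set 'cV[R]_m -> \bar R :=
  fun A => sm_cond M w [set o | A (T w (fun i => sm_Y M i o))].

(* measurableTypeR R is R with its Borel sets, in the form used by normal_prob. *)
Section standard_normal.
Context (R : realType).
Local Notation Rm := (measurableTypeR R).

Definition tuple_cons (m : nat) (xt : (Rm * m.-tuple Rm)%type) : m.+1.-tuple Rm :=
  [tuple of xt.1 :: xt.2].

Lemma measurable_tuple_cons (m : nat) :
  measurable_fun [set: (Rm * m.-tuple Rm)%type] (@tuple_cons m).
Proof. exact: measurable_cons. Qed.

HB.instance Definition _ m := isMeasurableFun.Build _ _ _ _ (@tuple_cons m)
  (@measurable_tuple_cons m).

Fixpoint std_normal_tuple (m : nat) : probability (m.-tuple Rm) R :=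
  match m with
  | 0 => \d_([tuple] : 0.-tuple Rm)
  | m'.+1 => distribution (normal_prob (0 : R) 1 \x std_normal_tuple m')%E
               (@tuple_cons m')
  end.

Definition std_normal (m : nat) : set 'cV[R]_m -> \bar R :=
  fun A => std_normal_tuple m [set t | A (\col_i tnth t i)].

End standard_normal.

Definition enlargement (R : realType) (m : nat) (A : set 'cV[R]_m) (e : R) :
    set 'cV[R]_m :=
  [set x | exists2 a, A a & enorm (x - a) < e].

(* <<s open >> is the Borel sigma-algebra of R^m. *)
Definition levy_prokhorov (R : realType) (m : nat)
    (P Q : set 'cV[R]_m -> \bar R) : R :=
  inf [set e | 0 < e /\ forall A, <<s @open 'cV[R]_m >> A ->
                 (P A <= Q (enlargement A e) + e%:E)%E].

(* Main.v *)
Require Import Defs.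
From HB Require Import structures.
From mathcomp Require Import all_boot all_order all_algebra.
From mathcomp Require Import all_classical all_reals all_analysis.
From mathcomp Require Import measurable_realfun.
From mathcomp Require Import ring lra complex.

Set Implicit Arguments.
Unset Strict Implicit.
Unset Printing Implicit Defensive.

Import Order.TTheory GRing.Theory Num.Theory.
Import numFieldNormedType.Exports.

Local Open Scope classical_set_scope.
Local Open Scope ring_scope.

(** The studentized estimator is a sum of independent centred vectors
    [(Y i - E Y i) *: a i], where [a i] is, up to the factor [#|S|^-1/2], the
    image of [Z i] under [N = Sigma^-1/2 Gamma^-1]. Since [N Delta N^T = I], the
    covariances add up to the identity, and since [Delta >= l I] the operator
    norm of [N] is at most [l^-1/2], so the moments of order [2 + delta] give a
    Lyapunov condition.

    For a Borel set [A] the indicator of its [r]-enlargement, averaged over a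
    Gaussian vector of standard deviation [sigma], differs from the indicators
    of [A] and of the [2r]-enlargement in the right directions up to the Gaussian
    tail beyond [r / sigma]. By the Cameron-Martin formula such an average of a
    function with values in [0,1] has a second order Taylor expansion along
    every direction, with a remainder that depends on [sigma] only. Lindeberg's
    replacement of the summands by Gaussian multiples of the [a i], one after
    the other, is therefore accurate uniformly in [A], which bounds the
    Levy-Prokhorov distance directly. The resulting Gaussian sum is standard
    normal because plane rotations preserve the Gaussian measure. *)

(** * The Gaussian measure on the line and in the plane *)

(** The estimate has to be uniform over all Borel sets [A], whose indicators have no regularity, so
    every derivative must fall on the Gaussian density and never on the function that is averaged.

    The Gaussian measure of R^m enters as a composition of one-dimensional averaging operators along
    a list of vectors, of which only the covariance matters. This fact is used twice: it makes an
    arbitrary direction one of the axes of the smoothing, which reduces the expansion to dimension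
    one, and it identifies the final Gaussian sum.

    With moments of order [2 + delta] only, a cubic remainder need not be integrable; the remainder
    is therefore [psi t], the product of t^2 and min(1, |t|). Below a truncation level [eta] it
    costs [eta] times a total variance, which is the trace of an identity matrix and hence a fixed
    dimension; above it, it costs the power [delta] of a quantity [kappa] of order |S|^(-1/2). The
    constants are chosen in the order tail radius, [sigma], [eta], sample size. *)

Section gauss1.
Context {R : realType}.
Local Notation Rm := (measurableTypeR R).
Local Notation mu := (@lebesgue_measure R).
Local Notation gam := (normal_prob (0 : R) 1).

Lemma measurable_affine (a b : R) :
  @measurable_fun _ _ Rm R setT (fun x => a * x + b).
Proof. by apply: measurable_funD. Qed.

(** The translated measure agrees with Lebesgue measure on half-open intervals, which determine
    it. *)
Lemma ge0_integral_translation (c : R) (f : Rm -> \bar R) :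
  measurable_fun setT f -> (forall x, 0 <= f x)%E ->
  (\int[mu]_x f (x + c)%R = \int[mu]_x f x)%E.
Proof.
move=> mf f0.
have ms : @measurable_fun _ _ Rm Rm setT (fun x : Rm => x + c).
  have : measurable_fun setT ((fun x : Rm => x + c) : Rm -> R).
    by apply: measurable_funD => //; exact: measurable_id.
  by [].
pose phi : {mfun Rm >-> Rm} := @mfun_Sub _ _ Rm Rm _ (mem_set ms).
have E (A : set Rm) : measurable A -> mu A = pushforward mu phi A.
  apply: lebesgue_measure_unique => X [[a b] /= _ <-].
  rewrite /pushforward.
  have -> : phi @^-1` `]a, b] = `]a - c, b - c]%classic.
    apply/seteqP; split=> x /=; rewrite !in_itv /=.
      by rewrite ltrBlDr lerBrDr.
    by rewrite ltrBlDr lerBrDr.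
  rewrite !lebesgue_measure_itv /= !lte_fin ltrD2r.
  by case: ifP => // _; rewrite -!EFinB; congr EFin; ring.
rewrite [RHS](@eq_measure_integral _ _ _ _ (pushforward mu phi)); last first.
  by move=> A mA _; exact: E.
by rewrite ge0_integral_pushforward.
Qed.


(** The Radon-Nikodym derivative and the density have the same integral over every measurable set,
    so they agree almost everywhere. *)
Lemma ge0_integral_normal (f : Rm -> \bar R) :
  measurable_fun setT f -> (forall x, 0 <= f x)%E ->
  (\int[gam]_x f x = \int[mu]_x (f x * (normal_pdf 0 1 x)%:E))%E.
Proof.
move=> mf f0.
have dom := normal_prob_dominates (0 : R) 1.
rewrite -(Radon_Nikodym_SigmaFinite.change_of_variables dom)//.
apply: ae_eq_integral => //.
- apply: emeasurable_funM => //; apply: (measurable_int mu).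
  exact: Radon_Nikodym_SigmaFinite.f_integrable.
- apply: emeasurable_funM => //.
  by apply/measurable_EFinP; exact: measurable_normal_pdf.
apply: ae_eqe_mul2l; apply: integral_ae_eq => //.
- exact: Radon_Nikodym_SigmaFinite.f_integrable.
- by apply/measurable_EFinP; exact: measurable_normal_pdf.
by move=> E _ mE; rewrite -Radon_Nikodym_SigmaFinite.f_integral.
Qed.

(** The normalizing constant can stay abstract: the identities below compare densities in which it
    cancels. *)
Lemma normal_pdf01E :
  {c : R | 0 < c & forall x, normal_pdf 0 1 x = c * expR (- (x ^+ 2 / 2))}.
Proof.
exists (normal_peak 1); first by rewrite normal_peak_gt0.
move=> x; rewrite normal_pdfE //; congr (_ * expR _).
by rewrite subr0 expr1n mulNr.
Qed.

(** Completing the square moves the translation from [f] to the density: at [x + t] the exponential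
    weight times the density is the density at [x]. *)
Lemma ge0_cameron_martin (t : R) (f : Rm -> \bar R) :
  measurable_fun setT f -> (forall x, 0 <= f x)%E ->
  (\int[gam]_x f (x + t)%R =
   \int[gam]_x (f x * (expR (t * x - t ^+ 2 / 2))%:E))%E.
Proof.
move=> mf f0.
have me (r : R) : measurable_fun setT ((fun x => expR (t * x - r)) : Rm -> R).
  exact: (measurableT_comp (@measurable_expR R) (measurable_affine t (- r))).
have ms (r : R) : measurable_fun setT ((fun x => x + r) : Rm -> Rm).
  by have := measurable_affine 1 r; under eq_fun do rewrite mul1r.
rewrite ge0_integral_normal//; last exact: (measurableT_comp mf (ms t)).
rewrite ge0_integral_normal; last 2 first.
- by apply: emeasurable_funM => //; exact/measurable_EFinP.
- by move=> x; rewrite mule_ge0 // lee_fin expR_ge0.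
rewrite -(@ge0_integral_translation t (fun x => (f x *
  (expR (t * x - t ^+ 2 / 2))%:E * (normal_pdf 0 1 x)%:E)%E)).
- apply: eq_integral => x _; rewrite -muleA; congr (_ * _)%E.
  have [c c0 E] := normal_pdf01E.
  rewrite -EFinM !E mulrCA -expRD; congr (c * expR _)%:E; by field.
- apply: emeasurable_funM => //.
    by apply: emeasurable_funM => //; exact/measurable_EFinP.
  by apply/measurable_EFinP; exact: measurable_normal_pdf.
- by move=> x; rewrite !mule_ge0 // lee_fin ?expR_ge0 ?normal_pdf_ge0.
Qed.

Lemma measurable_lin2 (a b : R) :
  measurable_fun setT ((fun z => a * z.1 + b * z.2) : (Rm * Rm)%type -> Rm).
Proof.
have : measurable_fun setT ((fun z => a * z.1 + b * z.2) : (Rm * Rm)%type -> R).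
  by apply: measurable_funD; apply: measurable_funM.
by [].
Qed.

Lemma ge0_integral_shear2 (t : R) (f : Rm * Rm -> \bar R) :
  measurable_fun setT f -> (forall z, 0 <= f z)%E ->
  (\int[mu]_x \int[mu]_y f (x, y + t * x)%R = \int[mu]_x \int[mu]_y f (x, y))%E.
Proof.
move=> mf f0; apply: eq_integral => x _.
rewrite (@ge0_integral_translation (t * x) (fun y => f (x, y))) //.
exact: measurableT_comp mf (pair1_measurable x).
Qed.

Lemma ge0_integral_shear1 (t : R) (f : Rm * Rm -> \bar R) :
  measurable_fun setT f -> (forall z, 0 <= f z)%E ->
  (\int[mu]_x \int[mu]_y f (x + t * y, y)%R = \int[mu]_x \int[mu]_y f (x, y))%E.
Proof.
move=> mf f0.
have ml : measurable_fun setT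
  ((fun z => (z.1 + t * z.2, z.2)) : (Rm * Rm)%type -> (Rm * Rm)%type).
  apply: measurable_fun_pair; last exact: measurable_snd.
  have := measurable_lin2 1 t; congr measurable_fun.
  by apply/funext => z; rewrite mul1r.
rewrite (fubini_tonelli (fun z : Rm * Rm => f (z.1 + t * z.2, z.2))%R)//; last first.
  exact: (measurableT_comp mf ml).
rewrite (fubini_tonelli f)//.
apply: eq_integral => y _.
rewrite (@ge0_integral_translation (t * y) (fun x => f (x, y))) //.
exact: measurableT_comp mf (pair2_measurable y).
Qed.

(* A rotation of angle other than pi is a product of three shears. *)
Lemma ge0_integral_rotation (c s : R) (f : Rm * Rm -> \bar R) :
  c ^+ 2 + s ^+ 2 = 1 -> 0 <= c ->
  measurable_fun setT f -> (forall z, 0 <= f z)%E ->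
  (\int[mu]_x \int[mu]_y f (c * x - s * y, s * x + c * y)%R =
   \int[mu]_x \int[mu]_y f (x, y))%E.
Proof.
(* [t] is minus the tangent of half the angle. The shears by [t], [s], [t] compose to the rotation
   because of [Ets] and [Et]; [0 <= c] keeps [1 + c] away from 0. *)
move=> cs c0 mf f0; set t := - s / (1 + c).
have c10 : 1 + c != 0 by rewrite gt_eqF // ltr_wpDr.
have Ets : 1 + t * s = c.
  have : s ^+ 2 = 1 - c ^+ 2 by rewrite -cs; ring.
  by move=> E; rewrite /t mulrAC mulNr -expr2 E; field.
have Et : t * (1 + c) = - s by rewrite /t divfK.
have m1 (r : R) : measurable_fun setT
  ((fun z => (z.1 + r * z.2, z.2)) : (Rm * Rm)%type -> (Rm * Rm)%type).
  apply: measurable_fun_pair; last exact: measurable_snd.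
  have := measurable_lin2 1 r; congr measurable_fun.
  by apply/funext => z; rewrite mul1r.
have m2 (r : R) : measurable_fun setT
  ((fun z => (z.1, z.2 + r * z.1)) : (Rm * Rm)%type -> (Rm * Rm)%type).
  apply: measurable_fun_pair; first exact: measurable_fst.
  have := measurable_lin2 r 1; congr measurable_fun.
  by apply/funext => z; rewrite mul1r addrC.
have mf1 := measurableT_comp mf (m1 t).
have mf2 := measurableT_comp mf1 (m2 s).
rewrite -(ge0_integral_shear1 t mf)//.
rewrite -(ge0_integral_shear2 s mf1 (fun=> f0 _)).
rewrite -(ge0_integral_shear1 t mf2 (fun=> f0 _)).
apply: eq_integral => x _; apply: eq_integral => y _ /=; congr (f (_, _)).
  by rewrite -mulNr -Et -Ets; ring.
by rewrite -Ets; ring.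
Qed.

(** The product density [p2] depends on x^2 + y^2 only, which the rotation preserves, so the
    Lebesgue case applies to [f] times [p2]. *)
Lemma ge0_normal_rotation (c s : R) (f : Rm * Rm -> \bar R) :
  c ^+ 2 + s ^+ 2 = 1 -> 0 <= c ->
  measurable_fun setT f -> (forall z, 0 <= f z)%E ->
  (\int[gam]_x \int[gam]_y f (c * x - s * y, s * x + c * y)%R =
   \int[gam]_x \int[gam]_y f (x, y))%E.
Proof.
move=> cs c0 mf f0.
pose p2 (z : Rm * Rm) : R := normal_pdf 0 1 z.2 * normal_pdf 0 1 z.1.
have p20 z : 0 <= p2 z by rewrite mulr_ge0// normal_pdf_ge0.
have mpdf := measurable_normal_pdf (0 : R) 1.
have mp2 : measurable_fun setT (p2 : (Rm * Rm)%type -> R).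
  apply: measurable_funM; apply: (measurableT_comp mpdf);
    [exact: measurable_snd|exact: measurable_fst].
have key (g : Rm * Rm -> \bar R) : measurable_fun setT g -> (forall z, 0 <= g z)%E ->
  (\int[gam]_x \int[gam]_y g (x, y) = \int[mu]_x \int[mu]_y (g (x, y) * (p2 (x, y))%:E))%E.
  move=> mg g0.
  rewrite ge0_integral_normal; last 2 first.
  - exact: (@measurable_fun_fubini_tonelli_F _ _ _ _ _ gam g).
  - by move=> x; apply: integral_ge0.
  apply: eq_integral => x _.
  have mgx : measurable_fun setT (fun y => g (x, y)).
    exact: measurableT_comp mg (pair1_measurable x).
  rewrite ge0_integral_normal// -ge0_integralZr//.
  - by apply: eq_integral => y _; rewrite -muleA -EFinM.
  - by apply: emeasurable_funM => //; exact/measurable_EFinP.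
  - by move=> y _; rewrite mule_ge0// lee_fin normal_pdf_ge0.
  - by rewrite lee_fin normal_pdf_ge0.
have mr : measurable_fun setT
  ((fun z => (c * z.1 - s * z.2, s * z.1 + c * z.2)) : (Rm * Rm)%type -> (Rm * Rm)%type).
  apply: measurable_fun_pair; last exact: measurable_lin2.
  have := measurable_lin2 c (- s); congr measurable_fun.
  by apply/funext => z; rewrite mulNr.
have mfr := measurableT_comp mf mr.
rewrite (key f)// (key _ mfr (fun=> f0 _)).
have mfp : measurable_fun setT ((fun z => f z * (p2 z)%:E)%E : (Rm * Rm)%type -> \bar R).
  by apply: emeasurable_funM => //; exact/measurable_EFinP.
have fp0 (z : Rm * Rm) : (0 <= f z * (p2 z)%:E)%E by rewrite mule_ge0// lee_fin.
apply: eq_trans _ (ge0_integral_rotation cs c0 mfp fp0).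
apply: eq_integral => x _; apply: eq_integral => y _; congr (_ * _%:E)%E.
  have [k k0 E] := normal_pdf01E.
  rewrite /p2 /= !E [LHS]mulrACA [RHS]mulrACA -!expRD; congr (k * k * expR _).
  have -> : y ^+ 2 = (c ^+ 2 + s ^+ 2) * y ^+ 2 by rewrite cs mul1r.
  have -> : x ^+ 2 = (c ^+ 2 + s ^+ 2) * x ^+ 2 by rewrite cs mul1r.
  by field.
Qed.
End gauss1.

(** * Taylor expansion of Gaussian averages *)

Section exp_taylor.
Context {R : realType}.
Implicit Types w x : R.

(** By the mean value theorem a bound on the derivative gains one power of |x| and keeps the
    exponential factor, so the lemma can be iterated along successive Taylor remainders. *)
Lemma mvt0_bound (f df : R -> R) (n : nat) :
  f 0 = 0 -> (forall x, is_derive x 1 f (df x)) ->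
  (forall x, `|df x| <= `|x| ^+ n * expR `|x|) ->
  forall x, `|f x| <= `|x| ^+ n.+1 * expR `|x|.
Proof.
move=> f0 dfE dfb x.
have cf (a b : R) : {within `[a, b], continuous f}.
  by apply: derivable_within_continuous => y _; case: (dfE y).
have key (c : R) : `|c| <= `|x| -> `|df c * x| <= `|x| ^+ n.+1 * expR `|x|.
  move=> cx; rewrite normrM exprS mulrC -mulrA ler_wpM2l//.
  apply: le_trans (dfb c) _; apply: ler_pM; rewrite ?exprn_ge0 ?expR_ge0//.
    by rewrite lerXn2r ?nnegrE.
  by rewrite ler_expR.
have [x0|x0] := leP 0 x.
  have [c] := MVT_segment x0 (fun y _ => dfE y) (cf 0 x).
  rewrite in_itv/= => /andP[c0 cx]; rewrite f0 !subr0 => ->.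
  by apply: key; rewrite !ger0_norm.
have [c] := MVT_segment (ltW x0) (fun y _ => dfE y) (cf x 0).
rewrite in_itv/= => /andP[cx c0]; rewrite f0 !sub0r mulrN => /eqP.
rewrite eqr_opp => /eqP ->.
by apply: key; rewrite (ler0_norm c0) (ltr0_norm x0) lerN2.
Qed.

Lemma expR_taylor2_bound w :
  `|expR w - 1 - w - w ^+ 2 / 2| <= `|w| ^+ 3 * expR `|w|.
Proof.
have d1 (y : R) : is_derive y 1 (fun y : R => expR y - 1) (expR y).
  by have := is_deriveB (is_derive_expR y) (is_derive_cst (1 : R) y 1); rewrite subr0.
have d2 (y : R) : is_derive y 1 (fun y : R => expR y - 1 - y) (expR y - 1).
  exact: is_deriveB (d1 y) (is_derive_id y 1).
have d3 (y : R) : is_derive y 1 (fun y : R => expR y - 1 - y - y ^+ 2 / 2)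
    (expR y - 1 - y).
  apply: is_deriveB (d2 y) _.
  have -> : (fun x : R => x ^+ 2 / 2) = 2^-1 \*: (id ^+ 2 : R -> R).
    by apply/funext => z /=; rewrite fctE /= mulrC.
  apply: (is_derive_eq (is_deriveZ 2^-1 (is_deriveX 2 (is_derive_id y 1)))).
  by rewrite /= scaler1 expr1 /GRing.scale /= mulrA mulVf ?mul1r.
have e1 := mvt0_bound (n := 0) _ d1; have e2 := mvt0_bound (n := 1) _ d2.
have e3 := mvt0_bound (n := 2) _ d3.
apply: e3; first by rewrite expR0 subrr subr0 expr0n mul0r subr0.
apply: e2; first by rewrite expR0 subrr subr0.
apply: e1 => [|y]; first by rewrite expR0 subrr.
by rewrite expr0 mul1r ger0_norm ?expR_ge0// ler_expR ler_norm.
Qed.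

End exp_taylor.

Section gauss_smooth.
Context {R : realType}.
Local Notation Rm := (measurableTypeR R).
Local Notation gam := (normal_prob (0 : R) 1).

Lemma integral_probability_cst d (T : measurableType d) (P : probability T R)
    (r : \bar R) :
  (\int[P]_x r = r)%E.
Proof.
by rewrite integral_cst// [X in (_ * X)%E](probability_setT P) mule1.
Qed.

Lemma integral_normal_expR (t : R) :
  (\int[gam]_x (expR (t * x - t ^+ 2 / 2))%:E = 1)%E.
Proof.
have := @ge0_cameron_martin R t (cst 1%E) (measurable_cst _) (fun=> lee01).
rewrite (integral_probability_cst (normal_prob 0 1)) => ->.
by apply: eq_integral => x _; rewrite mul1e.
Qed.

(* Dominates all the integrands below: the powers up to the fourth and the
   remainder [gauss_taylor_pointwise]. *)
Definition gdom (x : R) : R := expR (4 * x) + expR (- 4 * x).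

Lemma expR4_norm_le_gdom (x : R) : expR (4 * `|x|) <= gdom x.
Proof.
rewrite /gdom; have [x0|x0] := leP 0 x.
  by rewrite ger0_norm// lerDl expR_ge0.
by rewrite ltr0_norm// mulrN mulNr lerDr expR_ge0.
Qed.

Lemma integrable_gdom : gam.-integrable setT (EFin \o gdom).
Proof.
have m (a : R) : measurable_fun setT ((fun x => expR (a * x)) : Rm -> R).
  have := measurableT_comp (@measurable_expR R) (measurable_affine a 0).
  by congr measurable_fun; apply/funext => x /=; rewrite addr0.
have key (a : R) : gam.-integrable setT (EFin \o (fun x => expR (a * x))).
  apply/integrableP; split; first exact/measurable_EFinP.
  under eq_integral => x _ do rewrite /= ger0_norm ?expR_ge0//.
  have -> : (\int[gam]_x (expR (a * x))%:E =
      (expR (a ^+ 2 / 2))%:E * \int[gam]_x (expR (a * x - a ^+ 2 / 2))%:E)%E.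
    rewrite -ge0_integralZl//.
    - by apply: eq_integral => x _; rewrite -EFinM -expRD; congr (expR _)%:E; ring.
    - apply/measurable_EFinP.
      exact: (measurableT_comp (@measurable_expR R) (measurable_affine a (- _))).
  by rewrite integral_normal_expR mule1 ltry.
by apply: eq_integrable (integrableD measurableT (key 4) (key (- 4))) => //.
Qed.

Lemma integrable_normal_le (g : Rm -> R) (c : R) : measurable_fun setT g ->
  (forall x, `|g x| <= c * gdom x) -> gam.-integrable setT (EFin \o g).
Proof.
move=> mg gc; apply: (@le_integrable _ Rm R gam setT measurableT _
    (EFin \o (fun x : Rm => c * gdom x))) => //.
- exact/measurable_EFinP.
- by move=> x _; rewrite /= lee_fin (le_trans (gc x))// ler_norm.
- by apply: eq_integrable (integrableZl measurableT c integrable_gdom) => // x _.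
Qed.

Lemma norm_exp_le_gdom (n : nat) (x : R) : (n <= 4)%N -> `|x| ^+ n <= gdom x.
Proof.
move=> n4; apply: le_trans (expR4_norm_le_gdom x).
have [x1|x1] := leP `|x| 1.
  apply: (@le_trans _ _ 1); first by rewrite exprn_ile1.
  by rewrite -expR0 ler_expR mulr_ge0.
apply: (@le_trans _ _ (`|x| ^+ 4)); first by rewrite ler_eXn2l.
rewrite expRM_natl lerXn2r ?nnegrE ?expR_ge0//.
by apply: le_trans (expR_ge1Dx _); rewrite lerDr.
Qed.

(** The exponential is the generating function of the Hermite polynomials, and [x] and x^2 - 1 are
    the first two. With y = |x| + 1, both error terms are at most |t|^3 exp(4y), and exp(4y) =
    exp(4) exp(4|x|) explains the constant. *)
Lemma gauss_taylor_pointwise (t x : R) : `|t| <= 1 ->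
  `|expR (t * x - t ^+ 2 / 2) - 1 - t * x - t ^+ 2 * ((x ^+ 2 - 1) / 2)|
    <= 2 * expR 4 * `|t| ^+ 3 * gdom x.
Proof.
move=> t1; set q := t * x - t ^+ 2 / 2.
have -> : expR q - 1 - t * x - t ^+ 2 * ((x ^+ 2 - 1) / 2) =
  (expR q - 1 - q - q ^+ 2 / 2) + (t ^+ 4 / 8 - t ^+ 3 * x / 2).
  by rewrite /q; field.
set y := `|x| + 1; have y0 : 0 <= y by rewrite addr_ge0.
have yE : y <= expR y by apply: le_trans (expR_ge1Dx _); rewrite lerDr.
have E1 : 1 <= expR y by rewrite -expR0 ler_expR.
have qy : `|q| <= `|t| * y.
  apply: le_trans (ler_normB _ _) _.
  rewrite /y mulrDr mulr1 normrM lerD2l normrM normrX.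
  rewrite (ger0_norm (x := 2^-1)) // expr2 -mulrA ler_piMr//.
  by rewrite (le_trans (y := 1 * 1))// ler_pM// invf_le1// ler1n.
have b1 : `|expR q - 1 - q - q ^+ 2 / 2| <= `|t| ^+ 3 * (y ^+ 3 * expR y).
  apply: le_trans (expR_taylor2_bound _) _.
  rewrite mulrA -exprMn; apply: ler_pM; rewrite ?exprn_ge0 ?expR_ge0//.
    by rewrite lerXn2r ?nnegrE ?mulr_ge0.
  by rewrite ler_expR (le_trans qy)// ler_piMl.
have b2 : `|t ^+ 4 / 8 - t ^+ 3 * x / 2| <= `|t| ^+ 3 * y.
  have -> : t ^+ 4 / 8 - t ^+ 3 * x / 2 = t ^+ 3 * (t / 8 - x / 2) by field.
  rewrite normrM normrX ler_wpM2l ?exprn_ge0//.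
  apply: le_trans (ler_normB _ _) _; rewrite !normrM /y addrC.
  rewrite !(ger0_norm (x := _^-1)) //; apply: lerD.
    by rewrite ler_piMr// invf_le1// ler1n.
  by rewrite (le_trans (y := 1 * 1))// ler_pM// invf_le1// ler1n.
apply: le_trans (ler_normD _ _) _; apply: le_trans (lerD b1 b2) _.
have -> : 2 * expR 4 * `|t| ^+ 3 * gdom x = `|t| ^+ 3 * (2 * expR 4 * gdom x).
  by ring.
rewrite -mulrDr ler_wpM2l ?exprn_ge0//.
have y4 : y ^+ 3 * expR y <= expR (4 * y).
  have -> : expR (4 * y) = expR y ^+ 3 * expR y by rewrite expRM_natl -exprSr.
  by rewrite ler_wpM2r ?expR_ge0// lerXn2r ?nnegrE ?expR_ge0.
have y5 : y <= expR (4 * y).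
  by rewrite (le_trans yE)// ler_expR ler_peMl// ler1n.
apply: le_trans (lerD y4 y5) _.
rewrite -mulr2n -[leLHS]mulr_natl -mulrA ler_wpM2l//.
rewrite /y mulrDr mulr1 expRD mulrC ler_wpM2l ?expR_ge0//.
exact: expR4_norm_le_gdom.
Qed.

Definition unit_bounded T (k : T -> R) := forall x, 0 <= k x <= 1.

Lemma gauss_Rintegral_shift (t : R) (k : Rm -> R) :
  measurable_fun setT k -> unit_bounded k ->
  \int[gam]_x k (x + t) = \int[gam]_x (k x * expR (t * x - t ^+ 2 / 2)).
Proof.
move=> mk k01; rewrite /Rintegral; congr fine.
rewrite (@ge0_cameron_martin R t (EFin \o k)) //.
- exact/measurable_EFinP.
- by move=> x; rewrite lee_fin; have /andP[] := k01 x.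
Qed.

Lemma integrable_normal_unit_bounded (k g : Rm -> R) : measurable_fun setT k ->
  unit_bounded k -> gam.-integrable setT (EFin \o g) ->
  gam.-integrable setT (EFin \o (fun x => k x * g x)).
Proof.
move=> mk k01 ig; apply: (@le_integrable _ Rm R gam setT measurableT _ (EFin \o g)) => //.
- apply/measurable_EFinP; apply: measurable_funM => //.
  by have /integrableP[/measurable_EFinP] := ig.
- move=> x _; rewrite /= lee_fin normrM ler_piMl//.
  by have /andP[k0 k1] := k01 x; rewrite ger0_norm.
Qed.

Definition gauss_const : R := 2 * expR 4 * \int[gam]_x gdom x.

Lemma gauss_const_ge0 : 0 <= gauss_const.
Proof.
rewrite /gauss_const mulr_ge0 ?mulr_ge0 ?expR_ge0// Rintegral_ge0// => x _.
by rewrite addr_ge0 ?expR_ge0.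
Qed.

Lemma measurable_normal_exprn n : measurable_fun setT ((fun x => x ^+ n) : Rm -> R).
Proof. by apply: measurable_funX; exact: measurable_id. Qed.

Lemma measurable_normal_hermite2 :
  measurable_fun setT ((fun x => (x ^+ 2 - 1) / 2) : Rm -> R).
Proof.
have m := measurable_normal_exprn 2.
have := measurable_funB m (measurable_cst (1 : R)) => m1.
have := measurable_funM m1 (measurable_cst (2^-1 : R)).
by congr measurable_fun.
Qed.

Lemma integrable_normal_exprn n : (n <= 4)%N ->
  gam.-integrable setT (EFin \o (fun x : Rm => x ^+ n)).
Proof.
move=> n4; apply: (@integrable_normal_le _ 1) => [|x].
  exact: measurable_normal_exprn.
by rewrite mul1r normrX norm_exp_le_gdom.
Qed.

(** After the translation has been moved to the weight, the coefficients are the moments of [k]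
    against Hermite polynomials. Since [k] lies in [0,1], the pointwise remainder integrates to a
    constant that is free of [k]. *)
Lemma gauss_smooth_taylor (t : R) (k : Rm -> R) :
  measurable_fun setT k -> unit_bounded k -> `|t| <= 1 ->
  `|\int[gam]_x k (x + t) - \int[gam]_x k x - t * \int[gam]_x (k x * x)
     - t ^+ 2 * \int[gam]_x (k x * ((x ^+ 2 - 1) / 2))| <= gauss_const * `|t| ^+ 3.
Proof.
move=> mk k01 t1; rewrite gauss_Rintegral_shift//.
have iu := integrable_normal_unit_bounded mk k01.
have ie : gam.-integrable setT (EFin \o (fun x : Rm => expR (t * x - t ^+ 2 / 2))).
  apply: (@integrable_normal_le _ 1) => [|x].
    exact: (measurableT_comp (@measurable_expR R) (measurable_affine t (- _))).
  rewrite ger0_norm ?expR_ge0// mul1r; apply: le_trans (expR4_norm_le_gdom x).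
  rewrite ler_expR (@le_trans _ _ `|x|)//; last by rewrite ler_peMl// ler1n.
  apply: (@le_trans _ _ `|t * x|).
    by rewrite lerBlDr (le_trans (ler_norm _))// lerDl divr_ge0 ?sqr_ge0.
  by rewrite normrM ler_piMl.
have i1 : gam.-integrable setT (EFin \o (fun=> 1 : R)).
  by have := integrable_normal_exprn (isT : (0 <= 4)%N).
have ix := integrable_normal_exprn (isT : (1 <= 4)%N).
have i2 : gam.-integrable setT (EFin \o (fun x : Rm => (x ^+ 2 - 1) / 2)).
  apply: (@integrable_normal_le _ 2) => [|x].
    exact: measurable_normal_hermite2.
  rewrite normrM (ger0_norm (x := 2^-1))// (@le_trans _ _ (`|x ^+ 2 - 1| * 1))//.
    by rewrite ler_wpM2l// invf_le1// ler1n.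
  rewrite mulr1 (le_trans (ler_normB _ _))// mulr_natl mulr2n lerD//.
    by rewrite normrX norm_exp_le_gdom.
  by rewrite normr1 -(expr0 `|x|) norm_exp_le_gdom.
have ik : gam.-integrable setT (EFin \o k).
  by apply: eq_integrable (iu _ i1) => // x _; rewrite /= mulr1.
have ikx : gam.-integrable setT (EFin \o (fun x : Rm => k x * x)) := iu _ ix.
have ik2 := iu _ i2; have ike := iu _ ie.
have iz (a : R) (f : Rm -> R) : gam.-integrable setT (EFin \o f) ->
    gam.-integrable setT (EFin \o (fun x => a * f x)).
  by move=> /(integrableZl measurableT a); apply: eq_integrable => // x _.
have ib (f g : Rm -> R) : gam.-integrable setT (EFin \o f) ->
    gam.-integrable setT (EFin \o g) -> gam.-integrable setT (EFin \o (fun x => f x - g x)).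
  by move=> jf jg; apply: eq_integrable (integrableB measurableT jf jg) => // x _.
rewrite -(RintegralZl t) // -(RintegralZl (t ^+ 2)) //.
have j1 := ib _ _ ike ik; have j2 := ib _ _ j1 (iz t _ ikx).
have j3 := ib _ _ j2 (iz (t ^+ 2) _ ik2).
rewrite -RintegralB// -(RintegralB measurableT j1 (iz t _ ikx)).
rewrite -(RintegralB measurableT j2 (iz (t ^+ 2) _ ik2)).
apply: le_trans (le_normr_Rintegral measurableT j3) _.
have -> : gauss_const * `|t| ^+ 3 = \int[gam]_x (2 * expR 4 * `|t| ^+ 3 * gdom x).
  by rewrite RintegralZl//; [rewrite /gauss_const mulrAC|exact: integrable_gdom].
apply: le_Rintegral => //.
- by apply: eq_integrable (integrable_abse j3) => // x _.
- exact: iz integrable_gdom.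
move=> x _; apply: le_trans (gauss_taylor_pointwise x t1).
have -> : k x * expR (t * x - t ^+ 2 / 2) - k x - t * (k x * x)
     - t ^+ 2 * (k x * ((x ^+ 2 - 1) / 2)) = k x *
  (expR (t * x - t ^+ 2 / 2) - 1 - t * x - t ^+ 2 * ((x ^+ 2 - 1) / 2)) by ring.
have /andP[k0 k1] := k01 x.
by rewrite normrM ler_piMl// ger0_norm.
Qed.

Lemma Rintegral_probability_cst d (T : measurableType d) (P : probability T R)
    (r : R) : \int[P]_x r = r.
Proof. by rewrite /Rintegral integral_probability_cst. Qed.

(* Both follow from the expansion of the constant function 1. *)
Lemma normal_moments12 :
  \int[gam]_x (x : R) = 0 /\ \int[gam]_x ((x : R) ^+ 2) = 1.
Proof.
set c1 := (X in X = 0 /\ _).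
have i1 : gam.-integrable setT (EFin \o (fun=> 1 : R)).
  by have := integrable_normal_exprn (isT : (0 <= 4)%N).
have i2 := integrable_normal_exprn (isT : (2 <= 4)%N).
set c2 := \int[gam]_x (((x : R) ^+ 2 - 1) / 2).
have c2E : 2 * c2 + 1 = \int[gam]_x ((x : R) ^+ 2).
  rewrite /c2 RintegralZr//; last first.
    by apply: eq_integrable (integrableB measurableT i2 i1) => // x _.
  rewrite RintegralB// (Rintegral_probability_cst (normal_prob 0 1)).
  by field.
have H (t : R) : `|t| <= 1 -> `|t * c1 + t ^+ 2 * c2| <= gauss_const * `|t| ^+ 3.
  move=> t1; have := @gauss_smooth_taylor t (cst 1) (measurable_cst _) _ t1.
  rewrite /= !(Rintegral_probability_cst (normal_prob 0 1)) subrr sub0r.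
  rewrite -opprD normrN.
  under eq_Rintegral do rewrite mul1r.
  have -> : \int[gam]_x (1 * (((x : R) ^+ 2 - 1) / 2)) = c2.
    by apply: eq_Rintegral => x _; rewrite mul1r.
  by apply=> x; rewrite ler01 lexx.
(* The bounds at [t] and [- t] are added: [c1] cancels and 2 t^2 [c2] is of order t^3. *)
have H2 (t : R) : 0 < t -> t <= 1 -> `|c2| <= gauss_const * t.
  move=> t0 t1.
  have := H t; rewrite (gtr0_norm t0) => A.
  have := H (- t); rewrite normrN (gtr0_norm t0) => B.
  have := le_trans (ler_normD _ _) (lerD (A t1) (B t1)).
  have -> : t * c1 + t ^+ 2 * c2 + (- t * c1 + (- t) ^+ 2 * c2) = 2 * t ^+ 2 * c2 by ring.
  have t20 : 0 < 2 * t ^+ 2 by rewrite mulr_gt0// exprn_gt0.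
  rewrite normrM (gtr0_norm t20).
  have -> : gauss_const * t ^+ 3 + gauss_const * t ^+ 3 = 2 * t ^+ 2 * (gauss_const * t).
    by ring.
  by rewrite ler_pM2l.
have lim0 (c K : R) : 0 <= K -> (forall t, 0 < t -> t <= 1 -> `|c| <= K * t) -> c = 0.
  move=> K0 Hc; apply/eqP; rewrite -normr_le0; apply/ler_addgt0Pl => e e0.
  rewrite addr0; have K1 : 0 < K + 1 by rewrite ltr_wpDl.
  apply: (@le_trans _ _ (K * Num.min 1 (e / (K + 1)))).
    by apply: Hc; rewrite ?lt_min ?ltr01 ?divr_gt0// ge_min lexx.
  apply: (@le_trans _ _ ((K + 1) * (e / (K + 1)))); last first.
    by rewrite mulrC divfK// gt_eqF.
  apply: ler_pM => //; first by rewrite le_min ler01 ltW// divr_gt0.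
    by rewrite lerDl.
  by rewrite ge_min lexx orbT.
have c20 : c2 = 0 by exact: lim0 gauss_const_ge0 H2.
split; last by rewrite -c2E c20 mulr0 add0r.
apply: (@lim0 _ gauss_const) => [|t t0 t1]; first exact: gauss_const_ge0.
have := H t; rewrite c20 mulr0 addr0 normrM (gtr0_norm t0) => /(_ t1).
rewrite (_ : _ * t ^+ 3 = t * (gauss_const * t ^+ 2)); last by ring.
rewrite ler_pM2l// => /le_trans; apply.
by rewrite ler_wpM2l ?gauss_const_ge0// expr2 ler_piMl// ltW.
Qed.

(** Cubic near 0 but at most quadratic everywhere, hence integrable as soon as second moments are
    finite. *)
Definition psi (t : R) : R := t ^+ 2 * Num.min 1 `|t|.

(** [gauss_const] serves for |t| <= 1. For |t| > 1 the other three summands bound, relative to t^2,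
    the increment, the linear term and the quadratic term. *)
Definition smooth_const : R :=
  gauss_const + 1 + \int[gam]_x gdom x + \int[gam]_x gdom x.

Lemma unit_dist (a b : R) : 0 <= a <= 1 -> 0 <= b <= 1 -> `|a - b| <= 1.
Proof.
by move=> /andP[a0 a1] /andP[b0 b1]; rewrite ler_norml; apply/andP; split; lra.
Qed.

(** The coefficients are quantified before [t]: the same expansion is later integrated against two
    laws, so that its main terms cancel. *)
Lemma gauss_smooth_psi (k : Rm -> R) : measurable_fun setT k -> unit_bounded k ->
  exists c1 c2, forall t,
  `|\int[gam]_x k (x + t) - \int[gam]_x k x - t * c1 - t ^+ 2 * c2|
    <= smooth_const * psi t.
Proof.
move=> mk k01.
exists (\int[gam]_x (k x * x)), (\int[gam]_x (k x * ((x ^+ 2 - 1) / 2))) => t.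
have iu := integrable_normal_unit_bounded mk k01.
have G0 : 0 <= \int[gam]_x gdom x.
  by apply: Rintegral_ge0 => x _; rewrite addr_ge0 ?expR_ge0.
have [t1|t1] := leP `|t| 1.
  apply: le_trans (gauss_smooth_taylor mk k01 t1) _.
  rewrite /psi min_r// -normrX -(ger0_norm (sqr_ge0 t)) -normrM -exprSr normrX.
  rewrite ler_wpM2r ?exprn_ge0// /smooth_const -!addrA lerDl !addr_ge0//.
have bnd (g : Rm -> R) : measurable_fun setT g -> (forall x, `|g x| <= gdom x) ->
    `|\int[gam]_x (k x * g x)| <= \int[gam]_x gdom x.
  move=> mg gb.
  have ig : gam.-integrable setT (EFin \o g).
    by apply: (@integrable_normal_le _ 1) => // x; rewrite mul1r.
  apply: le_trans (le_normr_Rintegral measurableT (iu _ ig)) _.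
  apply: le_Rintegral => //.
  - by apply: eq_integrable (integrable_abse (iu _ ig)) => // x _.
  - exact: integrable_gdom.
  - move=> x _; have /andP[k0 k1] := k01 x.
    by rewrite normrM ger0_norm// (le_trans _ (gb x))// ler_piMl.
have U01 s : 0 <= \int[gam]_x k (x + s) <= 1.
  have ms : measurable_fun setT ((fun x => k (x + s)) : Rm -> R).
    apply: (measurableT_comp mk).
    by have := measurable_affine 1 s; under eq_fun do rewrite mul1r.
  rewrite Rintegral_ge0//=; last by move=> x _; have /andP[] := k01 (x + s).
  rewrite -[leRHS](Rintegral_probability_cst (normal_prob (0 : R) 1)).
  apply: le_Rintegral => //.
  - apply: (@integrable_normal_le _ 1) => // x; rewrite mul1r.
    have /andP[k0 k1] := k01 (x + s); rewrite ger0_norm// (le_trans k1)//.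
    by rewrite -(expr0 `|x|) norm_exp_le_gdom.
  - by have := integrable_normal_exprn (isT : (0 <= 4)%N).
  - by move=> x _; have /andP[] := k01 (x + s).
have c1b : `|\int[gam]_x (k x * x)| <= \int[gam]_x gdom x.
  apply: (bnd id) => [|x]; first exact: measurable_id.
  by rewrite -[`|_|]expr1 norm_exp_le_gdom.
have c2b : `|\int[gam]_x (k x * ((x ^+ 2 - 1) / 2))| <= \int[gam]_x gdom x.
  apply: (bnd (fun x => (x ^+ 2 - 1) / 2)) => [|x].
    exact: measurable_normal_hermite2.
  rewrite normrM (ger0_norm (x := 2^-1))// ler_pdivrMr//.
  rewrite (le_trans (ler_normB _ _))// mulr_natr mulr2n lerD//.
    by rewrite normrX norm_exp_le_gdom.
  by rewrite normr1 -(expr0 `|x|) norm_exp_le_gdom.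
rewrite /psi min_l ?mulr1; last exact: ltW.
have tt : `|t| <= t ^+ 2.
  by rewrite -(ger0_norm (sqr_ge0 t)) normrX expr2 ler_peMl// ltW.
have t21 : 1 <= t ^+ 2 by rewrite (le_trans (ltW t1)).
have k0E : \int[gam]_x k x = \int[gam]_x k (x + 0).
  by apply: eq_Rintegral => x _; rewrite addr0.
have D1 : `|\int[gam]_x k (x + t) - \int[gam]_x k x| <= t ^+ 2.
  rewrite k0E; have a01 := U01 t; have b01 := U01 0.
  exact/(le_trans _ t21)/unit_dist.
apply: le_trans (ler_normB _ _) _; apply: le_trans (lerD (ler_normB _ _) (lexx _)) _.
rewrite !normrM -expr2 -normrX (ger0_norm (sqr_ge0 t)).
apply: (@le_trans _ _ (t ^+ 2 + t ^+ 2 * \int[gam]_x gdom x +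
   t ^+ 2 * \int[gam]_x gdom x)).
  by rewrite !lerD// ler_pM ?sqr_ge0.
rewrite /smooth_const !mulrDl mul1r !(mulrC _ (t ^+ 2)) -!addrA lerDr.
by rewrite mulr_ge0 ?sqr_ge0 ?gauss_const_ge0.
Qed.

Lemma smooth_const_ge0 : 0 <= smooth_const.
Proof.
have G0 : 0 <= \int[gam]_x gdom x.
  by apply: Rintegral_ge0 => x _; rewrite addr_ge0 ?expR_ge0.
by rewrite !addr_ge0// gauss_const_ge0.
Qed.

End gauss_smooth.

(** * Averages over multiples of a vector *)

Section averages.
Context {R : realType} {m : nat}.
Local Notation Rm := (measurableTypeR R).
Local Notation V := 'cV[R]_m.
Local Notation gam := (normal_prob (0 : R) 1).

Definition col_of_tuple (t : m.-tuple Rm) : V := \col_i tnth t i.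

(* Measurability on R^m is expressed through the coordinates, as 'cV[R]_m carries
   no measurable structure. *)
Definition ubm (f : V -> R) :=
  measurable_fun setT (f \o col_of_tuple : m.-tuple Rm -> R) /\ unit_bounded f.

Definition cmeasurable d (T : measurableType d) (g : T -> V) :=
  forall i, measurable_fun setT (fun t => g t i 0).

(** [g] factors through the tuple of its coordinates. The form with a single set [A] serves for real
    functions and, with [f := id], for Borel sets. *)
Lemma cmeasurable_comp d (T : measurableType d) (U : Type) (f : V -> U) (g : T -> V)
    (A : set U) : cmeasurable g ->
  measurable ((f \o col_of_tuple) @^-1` A) -> measurable ((f \o g) @^-1` A).
Proof.
move=> mg mA; pose h t : m.-tuple Rm := [tuple g t i 0 | i < m].
have mh : measurable_fun setT h.
  apply/measurable_fun_tnthP => i.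
  rewrite (_ : _ \o _ = fun t => g t i 0); first exact: mg.
  by apply/funext => t /=; rewrite tnth_mktuple.
have hE t : col_of_tuple (h t) = g t.
  by apply/matrixP => i j; rewrite !mxE tnth_mktuple ord1.
have -> : (f \o g) @^-1` A = h @^-1` ((f \o col_of_tuple) @^-1` A).
  by apply/seteqP; split => t /=; rewrite hE.
by rewrite -[X in measurable X]setTI; exact: mh.
Qed.

Lemma ubm_comp d (T : measurableType d) (f : V -> R) (g : T -> V) :
  ubm f -> cmeasurable g -> measurable_fun setT (f \o g).
Proof.
move=> [mf _] mg _ A mA; rewrite setTI; apply: cmeasurable_comp => //.
by rewrite -[X in measurable X]setTI; exact: mf.
Qed.

Lemma cmeasurable_affine d (T : measurableType d) (X : T -> R) (x a : V) :
  measurable_fun setT X -> cmeasurable (fun o => x + X o *: a).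
Proof.
move=> mX i; under eq_fun do rewrite !mxE.
have := measurable_funM mX (measurable_cst (a i 0)).
exact: measurable_funD (measurable_cst (x i 0)).
Qed.

(** As an operator on functions: adding an independent summand composes operators, and replacing a
    summand replaces one factor. *)
Definition avg d (T : measurableType d) (P : probability T R) (X : T -> R)
  (a : V) (f : V -> R) (x : V) : R := \int[P]_o f (x + X o *: a).

Section avg_theory.
Context d (T : measurableType d) (P : probability T R) (X : T -> R).
Hypothesis mX : measurable_fun setT X.
Implicit Types (f g : V -> R) (a x : V).

Lemma unit_bounded_integrable (h : T -> R) : measurable_fun setT h -> unit_bounded h ->
  P.-integrable setT (EFin \o h).
Proof.
move=> mh h01; apply: (@le_integrable _ _ _ _ _ measurableT _ (cst 1%E)) => //.
- exact/measurable_EFinP.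
- move=> x _; rewrite /= lee_fin normr1; have /andP[h0 h1] := h01 x.
  by rewrite ger0_norm.
- exact: finite_measure_integrable_cst.
Qed.

Lemma avgE a f x : ubm f ->
  (avg P X a f x)%:E = (\int[P]_o (f (x + X o *: a))%:E)%E.
Proof.
move=> uf; rewrite /avg /Rintegral fineK// integrable_fin_num//.
apply: unit_bounded_integrable => [|o]; last exact: uf.2.
exact: (ubm_comp uf (cmeasurable_affine x a mX)).
Qed.

Lemma ubm_integrable a f x : ubm f ->
  P.-integrable setT (EFin \o (fun o => f (x + X o *: a))).
Proof.
move=> uf; apply: unit_bounded_integrable => [|o]; last exact: uf.2.
exact: (ubm_comp uf (cmeasurable_affine x a mX)).
Qed.

Lemma avg_ubm a f : ubm f -> ubm (avg P X a f).
Proof.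
move=> uf; split; last first.
  move=> x; rewrite -!lee_fin !avgE//; apply/andP; split.
    by apply: integral_ge0 => o _; rewrite lee_fin; have /andP[] := uf.2 (x + X o *: a).
  rewrite -[leRHS](integral_probability_cst P); apply: ge0_le_integral => //.
  - by move=> o _; rewrite lee_fin; have /andP[] := uf.2 (x + X o *: a).
  - by have /integrableP[] := ubm_integrable a x uf.
  - by move=> o _; rewrite lee_fin; have /andP[] := uf.2 (x + X o *: a).
apply/measurable_EFinP.
(* As a partial integral of a function on a product space, the average is measurable in the base
   point by Tonelli's theorem. *)
have -> : EFin \o (avg P X a f \o col_of_tuple) =
    fubini_F P (fun z : m.-tuple Rm * T => (f (col_of_tuple z.1 + X z.2 *: a))%:E).
  by apply/funext => t; rewrite /fubini_F /= avgE.
apply: measurable_fun_fubini_tonelli_F; last first.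
  by move=> z; rewrite lee_fin; have /andP[] := uf.2 (col_of_tuple z.1 + X z.2 *: a).
apply/measurable_EFinP; apply: (ubm_comp uf) => i.
under eq_fun do rewrite !mxE.
apply: measurable_funD.
  exact: (measurableT_comp (measurable_tnth i) measurable_fst).
apply: measurable_funM => //.
exact: (measurableT_comp mX measurable_snd).
Qed.

Lemma avg0 f x : avg P X 0 f x = f x.
Proof.
rewrite /avg; under eq_Rintegral do rewrite scaler0 addr0.
exact: Rintegral_probability_cst.
Qed.

(** Averaging is a contraction in the uniform norm; this carries the error of inner replacements
    through the outer averages. *)
Lemma avg_dist a f g e : ubm f -> ubm g -> (forall x, `|f x - g x| <= e) ->
  forall x, `|avg P X a f x - avg P X a g x| <= e.
Proof.
move=> uf ug fg x.
have jf := ubm_integrable a x uf; have jg := ubm_integrable a x ug.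
rewrite /avg -RintegralB//.
have jfg : P.-integrable setT
    (EFin \o (fun o => f (x + X o *: a) - g (x + X o *: a))).
  by apply: eq_integrable (integrableB measurableT jf jg) => // o _.
apply: le_trans (le_normr_Rintegral measurableT jfg) _.
rewrite -[leRHS](Rintegral_probability_cst P); apply: le_Rintegral => //.
- by apply: eq_integrable (integrable_abse jfg) => // o _.
- exact: finite_measure_integrable_cst.
Qed.

End avg_theory.

Lemma avg2E d1 (T1 : measurableType d1) (P1 : probability T1 R) (X1 : T1 -> R) a1
    d2 (T2 : measurableType d2) (P2 : probability T2 R) (X2 : T2 -> R) a2 (f : V -> R) x :
  measurable_fun setT X1 -> measurable_fun setT X2 -> ubm f ->
  (avg P1 X1 a1 (avg P2 X2 a2 f) x)%:E =
  (\int[P1]_y \int[P2]_z (f (x + X1 y *: a1 + X2 z *: a2))%:E)%E.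
Proof.
move=> m1 m2 uf; rewrite (avgE _ m1); last exact: avg_ubm.
by apply: eq_integral => o _; rewrite (avgE _ m2).
Qed.

Lemma avgC d1 (T1 : measurableType d1) (P1 : probability T1 R) (X1 : T1 -> R) a1
    d2 (T2 : measurableType d2) (P2 : probability T2 R) (X2 : T2 -> R) a2 (f : V -> R) :
  measurable_fun setT X1 -> measurable_fun setT X2 -> ubm f ->
  avg P1 X1 a1 (avg P2 X2 a2 f) = avg P2 X2 a2 (avg P1 X1 a1 f).
Proof.
move=> m1 m2 uf; apply/funext => x; apply: EFin_inj.
rewrite (avg2E _ _ _ _ _ m1 m2 uf) (avg2E _ _ _ _ _ m2 m1 uf).
pose F (z : T1 * T2) := (f (x + X1 z.1 *: a1 + X2 z.2 *: a2))%:E.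
have F0 z : (0 <= F z)%E.
  by rewrite lee_fin; have /andP[] := uf.2 (x + X1 z.1 *: a1 + X2 z.2 *: a2).
have mF : measurable_fun setT F.
  apply/measurable_EFinP; apply: (ubm_comp uf) => i.
  under eq_fun do rewrite !mxE.
  apply: measurable_funD.
    apply: measurable_funD => //; apply: measurable_funM => //.
    exact: (measurableT_comp m1 measurable_fst).
  apply: measurable_funM => //.
  exact: (measurableT_comp m2 measurable_snd).
apply: eq_trans (fubini_tonelli F mF F0) _.
by apply: eq_integral => o2 _; apply: eq_integral => o1 _; rewrite /F /= addrAC.
Qed.

Definition navg (a : V) (f : V -> R) : V -> R := avg gam (id : Rm -> R) a f.

Let mid : measurable_fun setT (id : Rm -> R). Proof. exact: measurable_id. Qed.

Lemma navg_ubm a f : ubm f -> ubm (navg a f).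
Proof. exact: avg_ubm. Qed.

Lemma navgC a b f : ubm f -> navg a (navg b f) = navg b (navg a f).
Proof. exact: avgC. Qed.

(** Rotating the two independent Gaussian coefficients amounts to rotating the pair of vectors the
    opposite way. *)
Lemma navg_rotation c s a b f : c ^+ 2 + s ^+ 2 = 1 -> 0 <= c -> ubm f ->
  navg a (navg b f) = navg (c *: a + s *: b) (navg (c *: b - s *: a) f).
Proof.
move=> cs c0 uf; apply/funext => x; apply: EFin_inj.
have E2 a' b' := avg2E gam a' gam b' x mid mid uf.
apply: eq_trans (E2 a b) _; apply: eq_trans _ (esym (E2 _ _)).
pose F (z : Rm * Rm) := (f (x + (z.1 : R) *: a + (z.2 : R) *: b))%:E.
have F0 z : (0 <= F z)%E.
  by rewrite lee_fin; have /andP[] := uf.2 (x + (z.1 : R) *: a + (z.2 : R) *: b).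
have mF : measurable_fun setT F.
  apply/measurable_EFinP; apply: (ubm_comp uf) => i.
  under eq_fun do rewrite !mxE.
  by apply: measurable_funD; first apply: measurable_funD => //; apply: measurable_funM.
apply: eq_trans (esym (ge0_normal_rotation cs c0 mF F0)) _.
apply: eq_integral => y1 _; apply: eq_integral => y2 _; rewrite /F /=; congr (f _)%:E.
by apply/matrixP => i j; rewrite !mxE; ring.
Qed.

Lemma navg0 f : navg 0 f = f.
Proof. by apply/funext => x; exact: avg0. Qed.

Lemma navgN a f : ubm f -> navg (- a) f = navg a f.
Proof.
(* A quarter turn sends the pair [a], [0] to the pair [0], [- a]. *)
move=> uf; have cs : (0 : R) ^+ 2 + 1 ^+ 2 = 1 by rewrite expr0n expr1n add0r.
have := navg_rotation a 0 cs (lexx _) uf.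
by rewrite !scale0r scaler0 scale1r addr0 sub0r !navg0.
Qed.

End averages.

(** * Gaussian averages are determined by their covariance *)

Section gaussian_lists.
Context {R : realType} {m : nat}.
Local Notation Rm := (measurableTypeR R).
Local Notation V := 'cV[R]_m.
Local Notation gam := (normal_prob (0 : R) 1).
Implicit Types (f : V -> R) (bs : seq V).

Definition navgs bs f : V -> R := foldr navg f bs.

Definition cov bs (i k : 'I_m) : R := \sum_(b <- bs) b i 0 * b k 0.

Lemma navgs_ubm bs f : ubm f -> ubm (navgs bs f).
Proof. by move=> uf; elim: bs => //= b bs; exact: navg_ubm. Qed.

Lemma navg_navgs a bs f : ubm f -> navg a (navgs bs f) = navgs bs (navg a f).
Proof.
move=> uf; elim: bs => //= b bs IH.
by rewrite -IH navgC//; exact: navgs_ubm.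
Qed.

Lemma rotation_annihilating (u v : R) :
  exists c s, [/\ c ^+ 2 + s ^+ 2 = 1, 0 <= c & c * v - s * u = 0].
Proof.
have [/eqP|] := eqVneq (u ^+ 2 + v ^+ 2) 0.
  rewrite paddr_eq0 ?sqr_ge0// !sqrf_eq0 => /andP[/eqP -> /eqP ->].
  by exists 1, 0; split; rewrite ?expr1n ?expr0n ?addr0 ?mulr0 ?subr0 ?ler01.
move=> uv0; pose r := Num.sqrt (u ^+ 2 + v ^+ 2).
have r2 : r ^+ 2 = u ^+ 2 + v ^+ 2 by rewrite sqr_sqrtr// addr_ge0 ?sqr_ge0.
have r0 : r != 0 by rewrite -sqrf_eq0 r2.
have rge : 0 <= r by rewrite sqrtr_ge0.
(* Both signs of the unit vector (u, v) / r annihilate; the one with nonnegative first entry is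
   taken, as the rotation lemma asks for [0 <= c]. *)
have [u0|u0] := leP 0 u.
  exists (u / r), (v / r); split; [|by rewrite divr_ge0|by field].
  by rewrite !expr_div_n -mulrDl -r2 divff// sqrf_eq0.
exists (- u / r), (- v / r); split; [|by rewrite divr_ge0// oppr_ge0 ltW|by field].
by rewrite !expr_div_n !sqrrN -mulrDl -r2 divff// sqrf_eq0.
Qed.

(* Givens rotations of pairs of vectors, which leave the Gaussian average and the
   covariance unchanged, concentrate coordinate j in a single vector. *)
Lemma navgs_eliminate (j : 'I_m) bs : exists c0 cs,
  [/\ forall f, ubm f -> navgs bs f = navgs (c0 :: cs) f,
      forall i k, cov bs i k = cov (c0 :: cs) i k,
      {in cs, forall c : V, c j 0 = 0} &
      forall i, {in bs, forall b : V, b i 0 = 0} ->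
        {in c0 :: cs, forall c : V, c i 0 = 0}].
Proof.
elim: bs => [|b bs [c0 [cs [IHf IHc IHj IHi]]]].
  exists 0, [::]; split => //.
  - by move=> f _; rewrite /= navg0.
  - by move=> i k; rewrite /cov big_seq1 big_nil !mxE mul0r.
  - by move=> i _ c; rewrite inE => /eqP ->; rewrite mxE.
have [c [s [cs1 cge ann]]] := rotation_annihilating (b j 0) (c0 j 0).
exists (c *: b + s *: c0), (c *: c0 - s *: b :: cs); split.
- move=> f uf; rewrite /= (IHf f uf) /= (navg_rotation _ _ cs1 cge)//.
  exact: navgs_ubm.
- move=> i k; have := IHc i k; rewrite /cov !big_cons => ->; rewrite !mxE !addrA; congr (_ + _).
  transitivity ((c ^+ 2 + s ^+ 2) * (b i 0 * b k 0 + c0 i 0 * c0 k 0)); last by ring.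
  by rewrite cs1 mul1r.
- move=> d; rewrite inE => /orP[/eqP ->|]; last exact: IHj.
  by rewrite !mxE.
- move=> i bi0 d; have bi : b i 0 = 0 by apply: bi0; rewrite mem_head.
  have ci : c0 i 0 = 0.
    by apply: IHi; rewrite ?mem_head// => e ebs; apply: bi0; rewrite inE ebs orbT.
  rewrite !inE => /or3P[/eqP ->|/eqP ->|dcs].
  + by rewrite !mxE bi ci !mulr0 addr0.
  + by rewrite !mxE bi ci !mulr0 subr0.
  + apply: IHi; last by rewrite inE dcs orbT.
    by move=> e ebs; apply: bi0; rewrite inE ebs orbT.
Qed.

(** Induction on the coordinates still to be treated. Once coordinate [j] lives in [c0] alone, row
    [j] of the covariance is [c0 j 0] times [c0], so [c0] is plus or minus [tau] times a basis
    vector. When no coordinate is left, all vectors vanish. *)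
Lemma navgs_canonical_on (tau : R) (js : seq 'I_m) bs f : tau != 0 -> uniq js ->
  (forall i, i \notin js -> {in bs, forall b : V, b i 0 = 0}) ->
  (forall i k, cov bs i k = tau ^+ 2 * ((i == k) && (i \in js))%:R) -> ubm f ->
  navgs bs f = navgs [seq tau *: delta_mx j 0 | j <- js] f.
Proof.
move=> tau0; elim: js bs => [|j js IH] bs /=.
  move=> _ b0 _ uf; elim: bs b0 => //= b bs IHbs b0.
  have -> : b = 0 by apply/matrixP => i k; rewrite ord1 mxE b0// mem_head.
  rewrite navg0; apply: IHbs => i ijs e ebs.
  by apply: b0; rewrite // inE ebs orbT.
move=> /andP[jjs ujs] b0 covE uf.
have [c0 [cs [Ef Ec Ej Ei]]] := navgs_eliminate j bs.
have covc i k : cov cs i k = cov bs i k - c0 i 0 * c0 k 0.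
  by rewrite Ec /cov big_cons addrAC subrr add0r.
have csj k : cov cs j k = 0.
  by rewrite /cov big_seq big1// => c ccs; rewrite Ej// mul0r.
have c0j k : c0 j 0 * c0 k 0 = tau ^+ 2 * (j == k)%:R.
  have /esym/eqP := covc j k; rewrite csj subr_eq0 => /eqP <-.
  by rewrite covE mem_head andbT.
have c0j2 : c0 j 0 ^+ 2 = tau ^+ 2 by rewrite expr2 c0j eqxx mulr1.
have c0j0 : c0 j 0 != 0 by rewrite -sqrf_eq0 c0j2 sqrf_eq0.
have c0k k : k != j -> c0 k 0 = 0.
  move=> kj; have /eqP := c0j k; rewrite (eq_sym j) (negbTE kj) mulr0 mulf_eq0.
  by rewrite (negbTE c0j0) => /eqP.
(* The covariance fixes [c0] up to sign only; [navgN] removes the ambiguity. *)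
have navgc0 g : ubm g -> navg c0 g = navg (tau *: delta_mx j 0) g.
  move=> ug; move/eqP: c0j2; rewrite eqf_sqr => /orP[/eqP E|/eqP E].
    congr (navg _ g); apply/matrixP => k l; rewrite ord1 !mxE eqxx andbT.
    by have [->|kj] := eqVneq k j; rewrite ?mulr1// c0k// mulr0.
  rewrite -navgN//; congr (navg _ g); apply/matrixP => k l; rewrite ord1 !mxE eqxx andbT.
  have [->|kj] := eqVneq k j; rewrite ?mulr1 ?E ?opprK// c0k// mulr0 oppr0//.
rewrite Ef//= navgc0; last exact: navgs_ubm.
congr (navg _); apply: IH => //.
- move=> i ijs c ccs; have [->|ij] := eqVneq i j; first exact: Ej.
  apply: Ei; last by rewrite inE ccs orbT.
  by apply: b0; rewrite inE negb_or ij.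
- move=> i k; rewrite covc covE inE.
  have [->|ij] := eqVneq i j.
    by rewrite c0j andbT (negbTE jjs) andbF mulr0 subrr.
  by rewrite c0k// mul0r subr0.
Qed.

(** Convolution with the centred Gaussian law of covariance tau^2 I. It is the smoothing for
    [tau = sigma] and the limit law for [tau = 1]. *)
Definition gsmooth (tau : R) f := navgs [seq tau *: delta_mx j 0 | j <- enum 'I_m] f.

Lemma navgs_canonical (tau : R) bs f : tau != 0 ->
  (forall i k, cov bs i k = tau ^+ 2 * (i == k)%:R) -> ubm f ->
  navgs bs f = gsmooth tau f.
Proof.
move=> tau0 covE uf; apply: navgs_canonical_on => //; first exact: enum_uniq.
  by move=> i; rewrite mem_enum.
by move=> i k; rewrite mem_enum andbT.
Qed.

Lemma gsmooth_ubm tau f : ubm f -> ubm (gsmooth tau f).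
Proof. exact: navgs_ubm. Qed.

Lemma enorm_ge0 k (v : 'cV[R]_k) : 0 <= enorm v.
Proof. exact: sqrtr_ge0. Qed.

Lemma enorm_sqr k (v : 'cV[R]_k) : enorm v ^+ 2 = \sum_i v i 0 ^+ 2.
Proof. by rewrite sqr_sqrtr// sumr_ge0// => i _; exact: sqr_ge0. Qed.

Lemma enorm_eq0 k (v : 'cV[R]_k) : (enorm v == 0) = (v == 0).
Proof.
apply/idP/eqP => [|->].
  rewrite -sqrf_eq0 enorm_sqr psumr_eq0 => [/allP v0|i _]; last exact: sqr_ge0.
  apply/matrixP => i j; rewrite ord1 mxE.
  by have := v0 i; rewrite mem_index_enum sqrf_eq0 => /(_ erefl)/eqP.
rewrite -sqrf_eq0 enorm_sqr big1// => i _; by rewrite mxE expr0n.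
Qed.

(* The covariance sigma^2 I is split into the part carried by the direction a and
   the orthogonal projection, whose columns q j complete the family. *)
Lemma gsmooth_direction (sigma : R) (a : V) f : 0 < sigma -> a != 0 -> ubm f ->
  exists2 g, ubm g & gsmooth sigma f = navg ((sigma / enorm a) *: a) g.
Proof.
move=> s0 a0 uf.
have na0 : enorm a != 0 by rewrite enorm_eq0.
pose q (j : 'I_m) : V := \col_i (sigma * ((i == j)%:R - a i 0 * a j 0 / enorm a ^+ 2)).
exists (navgs [seq q j | j <- enum 'I_m] f); first exact: navgs_ubm.
rewrite -[RHS]/(navgs ((sigma / enorm a) *: a :: [seq q j | j <- enum 'I_m]) f).
apply/esym/navgs_canonical => //; first by rewrite gt_eqF.
move=> i k; rewrite /cov big_cons big_map big_enum /=.
have -> : \sum_(j : 'I_m) q j i 0 * q j k 0 = sigma ^+ 2 *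
    ((i == k)%:R - a i 0 * a k 0 / enorm a ^+ 2).
  under eq_bigr => j _ do rewrite !mxE mulrACA -expr2.
  rewrite -mulr_sumr; congr (_ * _).
  have -> : \sum_(j < m) ((i == j)%:R - a i 0 * a j 0 / enorm a ^+ 2) *
      ((k == j)%:R - a k 0 * a j 0 / enorm a ^+ 2) =
      \sum_(j < m) ((i == j)%:R * (k == j)%:R) -
      a k 0 / enorm a ^+ 2 * (\sum_(j < m) (i == j)%:R * a j 0) -
      a i 0 / enorm a ^+ 2 * (\sum_(j < m) (k == j)%:R * a j 0) +
      a i 0 * a k 0 / enorm a ^+ 4 * (\sum_(j < m) a j 0 ^+ 2).
    rewrite !mulr_sumr -!sumrB -big_split /=; apply: eq_bigr => j _.
    by field.
  have pick (l : 'I_m) (h : 'I_m -> R) : \sum_(j < m) (l == j)%:R * h j = h l.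
    rewrite (bigD1 l)//= eqxx mul1r big1 ?addr0// => j jl.
    by rewrite eq_sym (negbTE jl) mul0r.
  by rewrite !pick -enorm_sqr (eq_sym k); field.
by rewrite !mxE; field.
Qed.

(** Along [a] the smoothing contains a one-dimensional Gaussian average with step [sigma / enorm a],
    so a displacement by [h *: a] shifts the Gaussian variable by [h * enorm a / sigma]. *)
Lemma gsmooth_taylor (sigma : R) (a : V) f x : 0 < sigma -> ubm f ->
  exists c1 c2, forall h,
  `|gsmooth sigma f (x + h *: a) - gsmooth sigma f x - h * c1 - h ^+ 2 * c2|
    <= @smooth_const R * psi (h * enorm a / sigma).
Proof.
move=> s0 uf; have [->|a0] := eqVneq a 0.
  exists 0, 0 => h; rewrite scaler0 addr0 !mulr0 subrr !subr0 normr0.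
  by rewrite mulr_ge0 ?smooth_const_ge0// mulr_ge0 ?sqr_ge0// le_min ler01 normr_ge0.
have na0 : enorm a != 0 by rewrite enorm_eq0.
have sn0 : sigma != 0 by rewrite gt_eqF.
have [g ug ->] := gsmooth_direction s0 a0 uf.
set e := _ *: a; pose k (y : Rm) := g (x + (y : R) *: e).
have mk : measurable_fun setT k.
  by apply: (ubm_comp ug (cmeasurable_affine x e _)); exact: measurable_id.
have k01 : unit_bounded k by move=> y; exact: ug.2.
have [c1 [c2 H]] := gauss_smooth_psi mk k01.
exists (c1 * (enorm a / sigma)), (c2 * (enorm a / sigma) ^+ 2) => h.
have := H (h * enorm a / sigma); set t := _ / sigma.
have -> : t * c1 = h * (c1 * (enorm a / sigma)) by rewrite /t; ring.
have -> : t ^+ 2 * c2 = h ^+ 2 * (c2 * (enorm a / sigma) ^+ 2) by rewrite /t; ring.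
suff -> : \int[gam]_y k (y + t) = navg e g (x + h *: a) by [].
rewrite /t; apply: eq_Rintegral => y _; rewrite /k /e; congr g.
by apply/matrixP => i j; rewrite !mxE; field; rewrite na0.
Qed.

End gaussian_lists.

(** * Lindeberg replacement *)

Section lindeberg.
Context {R : realType} {m : nat}.
Local Notation Rm := (measurableTypeR R).
Local Notation V := 'cV[R]_m.
Local Notation gam := (normal_prob (0 : R) 1).

Lemma psi_ge0 (t : R) : 0 <= psi t.
Proof. by rewrite mulr_ge0 ?sqr_ge0// le_min ler01 normr_ge0. Qed.

Lemma psi_le_sqr (t : R) : psi t <= t ^+ 2.
Proof. by rewrite ler_piMr ?sqr_ge0// ge_min lexx. Qed.

Lemma measurable_psi : measurable_fun setT (psi : R -> R).
Proof.
apply: measurable_funM; first exact: measurable_funX.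
by apply: measurable_minr => //; exact: measurableT_comp.
Qed.

Section step.
Context d (T : measurableType d) (P : probability T R) (X : T -> R).
Hypothesis mX : measurable_fun setT X.
Hypothesis iX2 : P.-integrable setT (EFin \o (fun o => X o ^+ 2)).

Lemma integrable_of_sqr : P.-integrable setT (EFin \o X).
Proof.
have i1 : P.-integrable setT (EFin \o (cst 1 : T -> R)).
  exact: finite_measure_integrable_cst.
have i12 : P.-integrable setT (EFin \o (fun o => 1 + X o ^+ 2)).
  by apply: eq_integrable (integrableD measurableT i1 iX2) => // o _.
apply: (le_integrable measurableT _ _ i12) => [|o _]; first exact/measurable_EFinP.
rewrite /= lee_fin (ger0_norm (x := 1 + _)) ?addr_ge0 ?sqr_ge0//.
have [X1|X1] := leP `|X o| 1; first by rewrite (le_trans X1)// lerDl sqr_ge0.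
by rewrite -real_normK ?num_real// ler_wpDl// expr2 ler_peMl// ltW.
Qed.

Lemma integrable_psi (r : R) : P.-integrable setT (EFin \o (fun o => psi (X o * r))).
Proof.
have iX2r : P.-integrable setT (EFin \o (fun o => r ^+ 2 * X o ^+ 2)).
  by apply: eq_integrable (integrableZl measurableT (r ^+ 2) iX2) => // o _.
apply: (le_integrable measurableT _ _ iX2r) => [|o _].
  apply/measurable_EFinP; apply: (measurableT_comp measurable_psi).
  by apply: measurable_funM.
rewrite /= lee_fin ger0_norm ?psi_ge0// (le_trans (psi_le_sqr _))//.
by rewrite exprMn mulrC ler_norm.
Qed.

(** Integrating the expansion kills [c1] because the mean is 0, and leaves [v * c2]. This term is
    the same for a Gaussian variable of variance [v], so only the two remainders survive in a
    comparison. *)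
Lemma avg_gsmooth_taylor (sigma c1 c2 v : R) (a x : V) (f : V -> R) :
  0 < sigma -> ubm f -> \int[P]_o X o = 0 -> \int[P]_o (X o ^+ 2) = v ->
  (forall h, `|gsmooth sigma f (x + h *: a) - gsmooth sigma f x - h * c1 - h ^+ 2 * c2|
    <= @smooth_const R * psi (h * (enorm a / sigma))) ->
  `|avg P X a (gsmooth sigma f) x - gsmooth sigma f x - v * c2| <=
    @smooth_const R * \int[P]_o psi (X o * (enorm a / sigma)).
Proof.
move=> s0 uf X0 Xv H; have uS := gsmooth_ubm sigma uf.
have iS := ubm_integrable P mX a x uS.
have iX := integrable_of_sqr.
have ic : P.-integrable setT (EFin \o (cst (gsmooth sigma f x) : T -> R)).
  exact: finite_measure_integrable_cst.
have iXc : P.-integrable setT (EFin \o (fun o => X o * c1)).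
  by apply: eq_integrable (integrableZr measurableT c1 iX) => // o _.
have iX2c : P.-integrable setT (EFin \o (fun o => X o ^+ 2 * c2)).
  by apply: eq_integrable (integrableZr measurableT c2 iX2) => // o _.
have ib (g h : T -> R) : P.-integrable setT (EFin \o g) ->
    P.-integrable setT (EFin \o h) -> P.-integrable setT (EFin \o (fun o => g o - h o)).
  by move=> jg jh; apply: eq_integrable (integrableB measurableT jg jh) => // o _.
have j1 := ib _ _ iS ic; have j2 := ib _ _ j1 iXc; have j3 := ib _ _ j2 iX2c.
have -> : avg P X a (gsmooth sigma f) x - gsmooth sigma f x - v * c2 =
    \int[P]_o (gsmooth sigma f (x + X o *: a) - gsmooth sigma f x - X o * c1 - X o ^+ 2 * c2).
  rewrite (RintegralB measurableT j2 iX2c) (RintegralB measurableT j1 iXc).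
  rewrite (RintegralB measurableT iS ic) Rintegral_probability_cst.
  rewrite (RintegralZr c1 measurableT iX) (RintegralZr c2 measurableT iX2) X0 Xv.
  by rewrite mul0r subr0.
apply: le_trans (le_normr_Rintegral measurableT j3) _.
have jp := integrable_psi (enorm a / sigma).
rewrite -(RintegralZl _ measurableT jp); apply: le_Rintegral => //.
- by apply: eq_integrable (integrable_abse j3) => // o _.
- by apply: eq_integrable (integrableZl measurableT (@smooth_const R) jp) => // o _.
Qed.

End step.

Lemma navg_scale (r : R) (a x : V) (f : V -> R) :
  navg (r *: a) f x = avg gam ((fun y => r * y) : Rm -> R) a f x.
Proof. by apply: eq_Rintegral => y _; rewrite scalerA mulrC. Qed.

Definition lindeberg_error d (T : measurableType d) (P : probability T R)
    (X : T -> R) (v r : R) : R :=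
  @smooth_const R * (\int[P]_o psi (X o * r) +
    \int[gam]_y psi (Num.sqrt v * y * r)).

Lemma lindeberg_step d (T : measurableType d) (P : probability T R) (X : T -> R)
    (sigma v : R) (a x : V) (f : V -> R) :
  measurable_fun setT X -> P.-integrable setT (EFin \o (fun o => X o ^+ 2)) ->
  \int[P]_o X o = 0 -> \int[P]_o (X o ^+ 2) = v ->
  0 < sigma -> ubm f ->
  `|avg P X a (gsmooth sigma f) x - navg (Num.sqrt v *: a) (gsmooth sigma f) x| <=
    lindeberg_error P X v (enorm a / sigma).
Proof.
move=> mX iX2 X0 Xv s0 uf.
have v0 : 0 <= v by rewrite -Xv; apply: Rintegral_ge0 => o _; rewrite sqr_ge0.
have [c1 [c2 H]] := gsmooth_taylor a x s0 uf.
have {}H h : `|gsmooth sigma f (x + h *: a) - gsmooth sigma f x - h * c1 - h ^+ 2 * c2|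
    <= @smooth_const R * psi (h * (enorm a / sigma)) by rewrite mulrA; exact: H.
have TX := avg_gsmooth_taylor mX iX2 s0 uf X0 Xv H.
have [g1 g2] := @normal_moments12 R.
have ix := @integrable_normal_exprn R 1 isT; have ix2 := @integrable_normal_exprn R 2 isT.
have mY : measurable_fun setT ((fun y => Num.sqrt v * y) : Rm -> R).
  by have := measurable_affine (Num.sqrt v) 0; under eq_fun do rewrite addr0.
have Y2 (y : R) : (Num.sqrt v * y) ^+ 2 = v * y ^+ 2 by rewrite exprMn sqr_sqrtr.
have iY2 : gam.-integrable setT (EFin \o (fun y : Rm => (Num.sqrt v * y) ^+ 2)).
  apply: eq_integrable (integrableZl measurableT v ix2) => // y _.
  by rewrite /= Y2.
have Y0 : \int[gam]_y (Num.sqrt v * y) = 0.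
  by rewrite RintegralZl// [X in _ * X]g1 mulr0.
have Yv : \int[gam]_y ((Num.sqrt v * y) ^+ 2) = v.
  under eq_Rintegral do rewrite Y2.
  by rewrite RintegralZl// [X in _ * X]g2 mulr1.
have TY := avg_gsmooth_taylor mY iY2 s0 uf Y0 Yv H.
rewrite navg_scale /lindeberg_error mulrDr.
apply: le_trans (lerD TX TY).
set A := avg _ _ _ _ _; set B := avg _ _ _ _ _; set S := gsmooth _ _ _.
have -> : A - B = (A - S - v * c2) - (B - S - v * c2) by ring.
exact: ler_normB.
Qed.

Lemma navgs_comm (bs cs : seq V) (f : V -> R) : ubm f ->
  navgs bs (navgs cs f) = navgs cs (navgs bs f).
Proof.
move=> uf; elim: bs => //= b bs ->.
by rewrite navg_navgs//; exact: navgs_ubm.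
Qed.

Section telescoping.
Context (I : eqType) d (T : measurableType d) (P : I -> probability T R)
  (X : I -> T -> R) (a : I -> V).
Hypothesis mX : forall i, measurable_fun setT (X i).

Definition avgs (l : seq I) (f : V -> R) : V -> R :=
  foldr (fun i => avg (P i) (X i) (a i)) f l.

Lemma avgs_ubm l f : ubm f -> ubm (avgs l f).
Proof. by move=> uf; elim: l => //= i l; exact: avg_ubm. Qed.

Lemma lindeberg_telescoping (b : I -> V) (err : I -> R) (sigma : R) l f :
  (forall i g x, i \in l -> ubm g ->
    `|avg (P i) (X i) (a i) (gsmooth sigma g) x - navg (b i) (gsmooth sigma g) x| <= err i) ->
  ubm f -> forall x,
  `|avgs l (gsmooth sigma f) x - navgs [seq b i | i <- l] (gsmooth sigma f) x|
    <= \sum_(i <- l) err i.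
Proof.
move=> H uf; elim: l H => [|i l IH] H x; first by rewrite big_nil subrr normr0.
rewrite big_cons /= [leRHS]addrC.
set N := navgs _ _; set A := avgs _ _.
have uS := gsmooth_ubm sigma uf.
have uN : ubm N by exact: navgs_ubm.
have uA : ubm A by exact: avgs_ubm.
apply: le_trans (ler_distD (avg (P i) (X i) (a i) N x) _ _) _; apply: lerD.
  apply: avg_dist => // y; apply: IH => j g z jl.
  by apply: H; rewrite inE jl orbT.
(* The error bound applies to smoothed functions only, so the smoothing is moved
   to the outside of the Gaussian averages. *)
rewrite /N /gsmooth navgs_comm//; apply: H; first by rewrite mem_head.
exact: navgs_ubm.
Qed.

End telescoping.
End lindeberg.

(** * Independent families and product laws *)

Section tuple_law.
Context d (T : measurableType d) (R : realType).

Definition tcons (n : nat) (xt : (T * n.-tuple T)%type) : n.+1.-tuple T :=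
  [tuple of xt.1 :: xt.2].

Lemma measurable_tcons (n : nat) : measurable_fun [set: (T * n.-tuple T)%type] (@tcons n).
Proof. exact: measurable_cons. Qed.

HB.instance Definition _ n := isMeasurableFun.Build _ _ _ _ (@tcons n)
  (@measurable_tcons n).

(** Same recursion as [std_normal_tuple], so that integrals against both are peeled off one
    coordinate at a time by the same lemma. *)
Fixpoint tuple_law (n : nat) : ('I_n -> probability T R) -> probability (n.-tuple T) R :=
  match n with
  | 0 => fun=> \d_([tuple] : 0.-tuple T)
  | n'.+1 => fun mu => distribution
      (mu ord0 \x tuple_law (fun i => mu (lift ord0 i)))%E (@tcons n')
  end.

Definition rectangle (n : nat) (B : 'I_n -> set T) : set (n.-tuple T) :=
  [set t | forall i, B i (tnth t i)].

Lemma measurable_rectangle n (B : 'I_n -> set T) :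
  (forall i, measurable (B i)) -> measurable (rectangle B).
Proof.
move=> mB; have -> : rectangle B = \bigcap_(i in [set: 'I_n]) ((@tnth n T)^~ i @^-1` B i).
  by apply/seteqP; split => [t H i _|t H i]; [exact: H|exact: (H i)].
apply: fin_bigcap_measurable => // i _; rewrite -[X in measurable X]setTI.
exact: measurable_tnth.
Qed.

Lemma tuple_law_rectangle n (mu : 'I_n -> probability T R) (B : 'I_n -> set T) :
  (forall i, measurable (B i)) ->
  tuple_law mu (rectangle B) = (\prod_(i < n) mu i (B i))%E.
Proof.
elim: n mu B => [|n IH] mu B mB.
  rewrite big_ord0 /= diracE mem_set// => -[] //.
rewrite big_ord_recl /= /distribution /pushforward.
have -> : @tcons n @^-1` rectangle B = B ord0 `*` rectangle (fun i => B (lift ord0 i)).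
  apply/seteqP; split => [[x t] /= H|[x t] /= [Bx H] i].
    split => [|i]; first by have := H ord0; rewrite (tnth_nth x).
    by have := H (lift ord0 i); rewrite tnthS; congr (B _ _); congr tnth; exact: val_inj.
  case: (unliftP ord0 i) => [j|] ->; last by rewrite (tnth_nth x).
  by have := H j; rewrite tnthS; congr (B _ _); congr tnth; exact: val_inj.
rewrite product_measure1E//; last exact: measurable_rectangle.
by congr (_ * _)%E; exact: IH.
Qed.

Lemma measurable_tupleE n : @measurable _ (n.-tuple T) =
  <<s [set A | exists2 B : 'I_n -> set T, (forall i, measurable (B i)) & A = rectangle B] >>.
Proof.
apply/seteqP; split; apply: smallest_sub.
- exact: smallest_sigma_algebra.
- move=> A; rewrite -bigcup_seq/= => -[i _ [C mC <-]].
  apply: sub_sigma_algebra; exists (fun j => if j == i then C else setT).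
    by move=> j; case: ifP.
  apply/seteqP; split => t /=.
    by move=> [_ Ct] j; case: ifP => // /eqP ->.
  by move=> /(_ i); rewrite eqxx.
- exact: sigma_algebra_measurable.
- by move=> A [B mB ->]; exact: measurable_rectangle.
Qed.

(** Rectangles are stable under intersection and generate the sigma-algebra, so two probabilities
    that agree on them are equal. *)
Lemma tuple_law_unique n (mu : 'I_n -> probability T R)
    (Q : probability (n.-tuple T) R) :
  (forall B, (forall i, measurable (B i)) ->
    Q (rectangle B) = (\prod_(i < n) mu i (B i))%E) ->
  forall A, measurable A -> Q A = tuple_law mu A.
Proof.
move=> QE A mA; apply: (measure_unique _ (fun=> setT) (measurable_tupleE n)) => //.
- move=> _ _ [B mB ->] [C mC ->]; exists (fun i => B i `&` C i).
    by move=> i; exact: measurableI.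
  apply/seteqP; split => t /=.
    by move=> [Bt Ct] i; split.
  by move=> H; split => i; have [] := H i.
- by move=> i; exists (fun=> setT) => //; apply/seteqP; split.
- by apply/seteqP; split => // x _; exists 0%N.
- by move=> _ [B mB ->]; apply: eq_trans (QE B mB) _; exact/esym/tuple_law_rectangle.
- by move=> k; rewrite (@le_lt_trans _ _ 1%E) ?ltry// probability_le1.
Qed.

Lemma ge0_integral_distribution_cons n (P : probability T R)
    (Q : probability (n.-tuple T) R) (c : {mfun (T * n.-tuple T)%type >-> n.+1.-tuple T})
    (f : n.+1.-tuple T -> \bar R) :
  measurable_fun setT f -> (forall t, 0 <= f t)%E ->
  (\int[distribution (P \x Q)%E c]_t f t = \int[P]_x \int[Q]_t f (c (x, t)))%E.
Proof.
move=> mf f0; rewrite ge0_integral_distribution//.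
rewrite (fubini_tonelli1 (f \o c) _ (fun=> f0 _))//.
exact: measurableT_comp.
Qed.

End tuple_law.

Section tuple_average.
Context {R : realType} {m : nat}.
Local Notation Rm := (measurableTypeR R).
Local Notation V := 'cV[R]_m.
Local Notation gam := (normal_prob (0 : R) 1).

Lemma measurable_linear_tuple d (T : measurableType d) n (X : 'I_n -> T -> R)
    (a : 'I_n -> V) (x : V) :
  (forall i, measurable_fun setT (X i)) ->
  cmeasurable (fun t : n.-tuple T => x + \sum_(i < n) X i (tnth t i) *: a i).
Proof.
move=> mX j.
have -> : (fun t : n.-tuple T => (x + \sum_(i < n) X i (tnth t i) *: a i) j 0) =
    (fun t => x j 0 + \sum_(i < n) X i (tnth t i) * a i j 0).
  by apply/funext => t; rewrite !mxE summxE; congr (_ + _); apply: eq_bigr => i _; rewrite mxE.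
apply: measurable_funD => //; apply: measurable_sum => i.
apply: measurable_funM => //.
exact: (measurableT_comp (mX i) (measurable_tnth i)).
Qed.

(** The first coordinate becomes the outermost average and is absorbed into the base point, which is
    why [x] is arbitrary. *)
Lemma integral_tuple_law_avgs d (T : measurableType d) n (mu : 'I_n -> probability T R)
    (X : 'I_n -> T -> R) (a : 'I_n -> V) (f : V -> R) (x : V) :
  (forall i, measurable_fun setT (X i)) -> ubm f ->
  (\int[tuple_law mu]_t (f (x + \sum_(i < n) X i (tnth t i) *: a i)%R)%:E =
    (avgs mu X a (enum 'I_n) f x)%:E)%E.
Proof.
move=> mX uf; elim: n mu X a x mX => [|n IH] mu X a x mX.
  rewrite enum_ord0 /=.
  under eq_integral => t _ do rewrite big_ord0 addr0.
  exact: integral_probability_cst.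
rewrite enum_ordSl /= avgE//; last exact: avgs_ubm.
rewrite /= ge0_integral_distribution_cons.
- apply: eq_integral => y _.
  have -> : avgs mu X a [seq lift ord0 i | i <- enum 'I_n] f =
      avgs (fun i => mu (lift ord0 i)) (fun i => X (lift ord0 i))
        (fun i => a (lift ord0 i)) (enum 'I_n) f.
    by rewrite /avgs foldr_map.
  rewrite -IH//; apply: eq_integral => t _.
  rewrite big_ord_recl addrA (tnth_nth y) /=; congr (f (_ + _))%:E.
  apply: eq_bigr => i _; congr (X _ _ *: _).
  by rewrite tnthS; congr tnth; exact: val_inj.
- by apply/measurable_EFinP; apply: (ubm_comp uf); exact: measurable_linear_tuple.
- move=> t; rewrite lee_fin.
  by have /andP[] := uf.2 (x + \sum_(i < n.+1) X i (tnth t i) *: a i).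
Qed.

Lemma integral_std_normal_tuple_navgs n (a : 'I_n -> V) (f : V -> R) (x : V) : ubm f ->
  (\int[std_normal_tuple R n]_t (f (x + \sum_(i < n) (tnth t i : R) *: a i)%R)%:E =
    (navgs [seq a i | i <- enum 'I_n] f x)%:E)%E.
Proof.
move=> uf; have mid : measurable_fun setT (id : Rm -> R) by exact: measurable_id.
elim: n a x => [|n IH] a x.
  rewrite enum_ord0 /=.
  under eq_integral => t _ do rewrite big_ord0 addr0.
  exact: integral_probability_cst.
rewrite enum_ordSl /= [RHS]avgE//; last exact: navgs_ubm.
rewrite /= ge0_integral_distribution_cons.
- apply: eq_integral => y _; rewrite -map_comp -IH; apply: eq_integral => t _.
  rewrite big_ord_recl addrA (tnth_nth y) /=; congr (f (_ + _))%:E.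
  apply: eq_bigr => i _; congr (_ *: _).
  by rewrite tnthS; congr tnth; exact: val_inj.
- apply/measurable_EFinP; apply: (ubm_comp uf).
  exact: (measurable_linear_tuple a x (fun=> mid)).
- move=> t; rewrite lee_fin.
  by have /andP[] := uf.2 (x + \sum_(i < n.+1) (tnth t i : R) *: a i).
Qed.

Lemma integral_std_normal_gsmooth (tau : R) (f : V -> R) (x : V) : ubm f ->
  (\int[std_normal_tuple R m]_t (f (x + tau *: col_of_tuple t)%R)%:E =
    (gsmooth tau f x)%:E)%E.
Proof.
move=> uf; rewrite /gsmooth -integral_std_normal_tuple_navgs//.
apply: eq_integral => t _; congr (f (_ + _))%:E.
apply/matrixP => i j; rewrite ord1 !mxE summxE (bigD1 i)//= !mxE eqxx mulr1 mulrC.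
rewrite big1 ?addr0// => k ki.
by rewrite !mxE eq_sym (negbTE ki) !mulr0.
Qed.

End tuple_average.

(** * Borel sets and enlargements *)

Section euclidean_norm.
Context {R : realType} {m : nat}.
Local Notation V := 'cV[R]_m.
Implicit Types u v : V.

Lemma enormZ (c : R) v : enorm (c *: v) = `|c| * enorm v.
Proof.
apply/eqP; rewrite -(@eqrXn2 _ 2)// ?mulr_ge0 ?enorm_ge0//.
rewrite exprMn !enorm_sqr mulr_sumr real_normK ?num_real//; apply/eqP.
by apply: eq_bigr => i _; rewrite mxE exprMn.
Qed.

Lemma enormN v : enorm (- v) = enorm v.
Proof. by rewrite -scaleN1r enormZ normrN1 mul1r. Qed.

Lemma dot_le_enorm u v : \sum_i u i 0 * v i 0 <= enorm u * enorm v.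
Proof.
have [/eqP|u0] := eqVneq (enorm u) 0.
  rewrite enorm_eq0 => /eqP ->; rewrite big1 ?mulr_ge0 ?enorm_ge0// => i _.
  by rewrite mxE mul0r.
have [/eqP|v0] := eqVneq (enorm v) 0.
  rewrite enorm_eq0 => /eqP ->; rewrite big1 ?mulr_ge0 ?enorm_ge0// => i _.
  by rewrite mxE mulr0.
have uv0 : 0 < enorm u * enorm v by rewrite mulr_gt0// lt_def enorm_ge0 andbT.
have H : 0 <= \sum_i (u i 0 * enorm v - v i 0 * enorm u) ^+ 2.
  by apply: sumr_ge0 => i _; exact: sqr_ge0.
have E : \sum_i (u i 0 * enorm v - v i 0 * enorm u) ^+ 2 =
    2 * (enorm u * enorm v) * (enorm u * enorm v - \sum_i u i 0 * v i 0).
  transitivity (enorm v ^+ 2 * (\sum_i u i 0 ^+ 2) + enorm u ^+ 2 * (\sum_i v i 0 ^+ 2)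
    - 2 * (enorm u * enorm v) * (\sum_i u i 0 * v i 0)).
    rewrite !mulr_sumr -big_split -sumrB /=; apply: eq_bigr => i _; ring.
  by rewrite -!enorm_sqr; ring.
have c0 : 0 < 2 * (enorm u * enorm v) by exact: mulr_gt0.
by move: H; rewrite E (pmulr_rge0 _ c0) subr_ge0.
Qed.

Lemma enormD u v : enorm (u + v) <= enorm u + enorm v.
Proof.
rewrite -ler_sqr ?nnegrE ?addr_ge0 ?enorm_ge0//.
have -> : enorm (u + v) ^+ 2 = enorm u ^+ 2 + 2 * (\sum_i u i 0 * v i 0) + enorm v ^+ 2.
  rewrite !enorm_sqr mulr_sumr -!big_split /=; apply: eq_bigr => i _.
  by rewrite !mxE; ring.
rewrite sqrrD lerD2r lerD2l -[leRHS]mulr_natl ler_wpM2l//; exact: dot_le_enorm.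
Qed.

(** The factor [m.+1], cruder than the square root of [m], keeps the inequality strict when
    [m = 0]. *)
Lemma enorm_lt (v : V) (e : R) : 0 < e -> (forall i, `|v i 0| < e) ->
  enorm v < m.+1%:R * e.
Proof.
move=> e0 ve; rewrite -ltr_sqr ?nnegrE ?enorm_ge0 ?mulr_ge0 ?ltW//.
rewrite enorm_sqr exprMn; apply: (@le_lt_trans _ _ (\sum_(i < m) e ^+ 2)).
  by apply: ler_sum => i _; rewrite -real_normK ?num_real// ler_sqr ?nnegrE ?(ltW e0)// ltW.
rewrite sumr_const card_ord -[ltLHS]mulr_natl ltr_pM2r ?exprn_gt0//.
by rewrite -natrX ltr_nat expnS expn1 leq_pmulr.
Qed.

Lemma enlargement_enlargement (A : set V) (r s : R) x y :
  enlargement A r x -> enorm (y - x) < s -> enlargement A (r + s) y.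
Proof.
move=> [a Aa xa] yx; exists a => //.
rewrite -(subrKA x) (le_lt_trans (enormD _ _))// addrC ltrD//.
Qed.

(** Shared by the open sets of the matrix topology and by the Euclidean enlargements of arbitrary
    sets, so one covering argument makes both measurable. *)
Definition box_open (B : set V) := forall x : V, B x ->
  exists2 e : R, 0 < e & forall y : V, (forall i, `|y i 0 - x i 0| < e) -> B y.

Lemma enlargement_box_open (A : set V) (r : R) : box_open (enlargement A r).
Proof.
move=> x [a Aa xa]; exists ((r - enorm (x - a)) / m.+1%:R).
  by rewrite divr_gt0// subr_gt0.
move=> y yx; exists a => //.
rewrite -(subrKA x) (le_lt_trans (enormD _ _))//.
have : enorm (y - x) < m.+1%:R * ((r - enorm (x - a)) / m.+1%:R).
  apply: enorm_lt => [|i]; first by rewrite divr_gt0// subr_gt0.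
  by rewrite !mxE.
by rewrite mulrC divfK// ltrBrDr.
Qed.

Lemma open_box_open (B : set V) : open B -> box_open B.
Proof.
rewrite openE => oB x /oB /nbhs_ballP[e /= e0 eB]; exists e => // y yx.
by apply: eB; split => // i j; rewrite ord1 /ball /= distrC.
Qed.

(* A box-open set is a countable union of boxes with rational centres. *)
Lemma measurable_box_open (B : set V) : box_open B ->
  measurable (@col_of_tuple R m @^-1` B).
Proof.
move=> oB.
pose box (q : {ffun 'I_m -> rat} * nat) : set V :=
  [set y : V | forall i, `|y i 0 - ratr (q.1 i)| < q.2.+1%:R^-1].
pose F q := if `[< box q `<=` B >] then @col_of_tuple R m @^-1` box q else set0.
have -> : @col_of_tuple R m @^-1` B = \bigcup_q F q.
  apply/seteqP; split => [t /= Bt|t [q _]]; last first.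
    by rewrite /F; case: asboolP => // qB /qB.
  have [e e0 eB] := oB _ Bt.
  have [k ke] : exists k : nat, k.+1%:R^-1 < e / 2.
    have e20 : 0 < e / 2 by rewrite divr_gt0.
    exists (Num.bound (e / 2)^-1); rewrite invf_plt ?posrE//.
    have /archi_boundP/lt_trans : 0 <= (e / 2)^-1 by rewrite invr_ge0 ltW.
    by apply; rewrite ltr_nat.
  have /choice[q qP] (i : 'I_m) : exists q : rat, `|tnth t i - ratr q| < k.+1%:R^-1.
    have lt : tnth t i - k.+1%:R^-1 < tnth t i + k.+1%:R^-1.
      by rewrite ltrBlDr -addrA ltrDl addr_gt0// invr_gt0.
    have [q] := rat_in_itvoo lt; rewrite in_itv /= => /andP[q1 q2].
    exists q; rewrite ltr_norml; apply/andP; split.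
      by rewrite ltrBrDr addrC ltrBlDr.
    by rewrite ltrBlDr -ltrBlDl.
  exists ([ffun i => q i], k) => //; rewrite /F asboolT => [|y qy].
    by move=> i; rewrite ffunE mxE.
  apply: eB => i; apply: le_lt_trans (ler_distD (ratr (q i)) _ _) _.
  rewrite [ltRHS]splitr ltrD//.
    by have := qy i; rewrite ffunE => /lt_trans; apply.
  by rewrite distrC mxE (lt_trans (qP i)).
apply: countable_bigcupT_measurable => [|q]; first exact: countableP.
rewrite /F; case: ifP => // _.
have -> : @col_of_tuple R m @^-1` box q = \bigcap_(i in [set: 'I_m])
    [set t | `|tnth t i - ratr (q.1 i)| < q.2.+1%:R^-1].
  by apply/seteqP; split => [t /= H i _|t H i];
    [have := H i; rewrite mxE|rewrite mxE; exact: (H i)].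
apply: fin_bigcap_measurable => // i _.
have mt : measurable_fun setT
    ((fun t => `|tnth t i - ratr (q.1 i)|) : m.-tuple (measurableTypeR R) -> R).
  apply: measurableT_comp => //; apply: measurable_funB => //.
  exact: measurable_tnth.
have := mt measurableT _ (measurable_itv `]-oo, q.2.+1%:R^-1[).
by rewrite setTI; congr measurable; apply/seteqP; split => t /=; rewrite in_itv.
Qed.

Lemma measurable_borel (A : set V) : <<s @open V >> A ->
  measurable (@col_of_tuple R m @^-1` A).
Proof.
apply: (@smallest_sub _ _ _ [set B | measurable (@col_of_tuple R m @^-1` B)]).
  split => [|B mB|B mB].
  - by rewrite /= preimage_set0.
  - by rewrite /= setTD preimage_setC; exact: measurableC.
  - by rewrite /= preimage_bigcup; exact: bigcupT_measurable.
by move=> B oB; apply: measurable_box_open; exact: open_box_open.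
Qed.

End euclidean_norm.

(** * Independent outcomes and the product of their laws *)

Section independent_sum.
Context {R : realType} {m n : nat}.
Context d (W : measurableType d) (P : probability W R) (Y : 'I_n -> {mfun W >-> R}).
Hypothesis indY : mutually_independent P (fun i => Y i : W -> R).
Local Notation V := 'cV[R]_m.

Definition joint (o : W) : n.-tuple R := [tuple Y i o | i < n].

Lemma measurable_joint : measurable_fun setT joint.
Proof.
apply/measurable_fun_tnthP => i.
rewrite (_ : _ \o _ = Y i) => //.
by apply/funext => o; rewrite /joint /= tnth_mktuple.
Qed.

HB.instance Definition _ := isMeasurableFun.Build _ _ _ _ joint measurable_joint.

Lemma distribution_joint (A : set (n.-tuple R)) : measurable A ->
  distribution P joint A = tuple_law (fun i => distribution P (Y i)) A.
Proof.
apply: tuple_law_unique => B mB.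
have E : joint @^-1` rectangle B = \bigcap_(i in [set` [set: 'I_n]%SET]) (Y i @^-1` B i).
  apply/seteqP; split=> [z H i _|z H i] /=.
    by have := H i; rewrite /joint tnth_mktuple.
  by rewrite /joint tnth_mktuple; apply: (H i); rewrite /= inE.
apply: (eq_trans (congr1 P E)); rewrite indY//.
apply: eq_bigl => i; by rewrite inE.
Qed.

Lemma integral_independent (X : 'I_n -> R -> R) (a : 'I_n -> V) (f : V -> R) (x : V) :
  (forall i, measurable_fun setT (X i)) -> ubm f ->
  (\int[P]_o (f (x + \sum_(i < n) X i (Y i o) *: a i)%R)%:E =
   (avgs (fun i => distribution P (Y i)) X a (enum 'I_n) f x)%:E)%E.
Proof.
move=> mX uf; rewrite -integral_tuple_law_avgs//.
rewrite -(@eq_measure_integral _ _ _ _ (tuple_law (fun i => distribution P (Y i)))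
  (distribution P joint)); last first.
  by move=> A mA _; exact: distribution_joint.
rewrite ge0_integral_distribution//.
- apply: eq_integral => o _ /=; congr (f (_ + _))%:E.
  by apply: eq_bigr => i _; rewrite /joint tnth_mktuple.
- by apply/measurable_EFinP; apply: (ubm_comp uf); exact: measurable_linear_tuple.
- by move=> t; rewrite lee_fin; have /andP[] := uf.2 (x + \sum_(i < n) X i (tnth t i) *: a i).
Qed.

End independent_sum.

(** * Smoothed indicators and the Gaussian tail *)

Section indicators.
Context {R : realType} {m : nat}.
Local Notation V := 'cV[R]_m.
Local Notation std := (std_normal_tuple R m).

Lemma ubm_indic (B : set V) : measurable (@col_of_tuple R m @^-1` B) ->
  ubm (\1_B : V -> R).
Proof.
move=> mB; split; last by move=> x; rewrite indicE; case: (_ \in _); rewrite ?lexx ?ler01.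
rewrite (_ : _ \o _ = \1_(@col_of_tuple R m @^-1` B)); first exact: measurable_indic.
by apply/funext => t; rewrite /= !indicE.
Qed.

Definition std_tail (rho : R) : R :=
  1 - fine (std (@col_of_tuple R m @^-1` enlargement [set 0] rho)).

Lemma measurable_enlargement (A : set V) (r : R) :
  measurable (@col_of_tuple R m @^-1` enlargement A r).
Proof. by apply: measurable_box_open; exact: enlargement_box_open. Qed.

Lemma enlargement0 (r : R) (x : V) : enlargement [set 0] r x <-> enorm x < r.
Proof.
split; first by move=> [a ->]; rewrite subr0.
by move=> xr; exists 0 => //; rewrite subr0.
Qed.

Lemma std_tail_setC (rho : R) :
  std (~` (@col_of_tuple R m @^-1` enlargement [set 0] rho)) = (std_tail rho)%:E.
Proof.
have mE := @measurable_enlargement [set 0] rho.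
rewrite (probability_setC std mE) /std_tail EFinB fineK//.
exact: fin_num_measure.
Qed.

Lemma std_tail_ge0 (rho : R) : 0 <= std_tail rho.
Proof. by rewrite -lee_fin -std_tail_setC. Qed.

Lemma std_tail_small (e : R) : 0 < e -> exists2 rho : R, 0 < rho & std_tail rho < e.
Proof.
move=> e0.
pose F (k : nat) := @col_of_tuple R m @^-1` enlargement [set 0] k%:R.
have mF k : measurable (F k) by exact: measurable_enlargement.
have UF : \bigcup_k F k = setT.
  apply/seteqP; split => // t _; exists (Num.bound (enorm (@col_of_tuple R m t))) => //.
  by apply/enlargement0; apply: archi_boundP; exact: enorm_ge0.
have ndF : nondecreasing_seq F.
  move=> i j ij; apply/subsetPset => t /enlargement0 ti; apply/enlargement0.
  by rewrite (lt_le_trans ti)// ler_nat.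
have cF : std (F k) @[k --> \oo] --> 1%E.
  rewrite -(probability_setT std) -UF; apply: nondecreasing_cvg_mu => //.
  by rewrite UF; exact: measurableT.
have cf : fine (std (F k)) @[k --> \oo] --> (1 : R) by exact: fine_cvg.
have /cvgrPdist_lt /(_ e e0) [N _ HN] := cf.
exists N.+1%:R => //.
have := HN N.+1 (leqnSn N); apply: le_lt_trans.
exact: ler_norm.
Qed.

Section sandwich.
Context (A : set V) (sigma r : R).
Hypothesis sigma_gt0 : 0 < sigma.
Local Notation f := (\1_(enlargement A r) : V -> R).
Local Notation tail := (std_tail (r / sigma)).

Let uf : ubm f. Proof. by apply: ubm_indic; exact: measurable_enlargement. Qed.

Let shift_lt t : enlargement [set 0] (r / sigma) (@col_of_tuple R m t) ->
  enorm (sigma *: @col_of_tuple R m t) < r.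
Proof.
by move=> /enlargement0; rewrite enormZ gtr0_norm// ltr_pdivlMr// mulrC.
Qed.

Lemma gsmooth_indic_ge y : A y -> 1 - tail <= gsmooth sigma f y.
Proof.
move=> Ay; rewrite -lee_fin -integral_std_normal_gsmooth// /std_tail subKr fineK.
  set E := _ @^-1` _; have mE : measurable E by exact: measurable_enlargement.
  rewrite -[E]setIT -integral_indic//; apply: ge0_le_integral => //.
  - by apply/measurable_EFinP; exact: measurable_indic.
  - apply/measurable_EFinP; apply: (ubm_comp uf) => i.
    under eq_fun do rewrite !mxE.
    by apply: measurable_funD => //; apply: measurable_funM => //; exact: measurable_tnth.
  move=> t _; rewrite lee_fin !indicE; case: (boolP (t \in E)) => [|_]; last by rewrite ler0n.
  rewrite inE => /shift_lt tr; rewrite mem_set//.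
  by exists y => //; rewrite addrC addKr.
by apply: fin_num_measure; exact: measurable_enlargement.
Qed.

Lemma gsmooth_indic_le y : gsmooth sigma f y <= \1_(enlargement A (r + r)) y + tail.
Proof.
rewrite -lee_fin -integral_std_normal_gsmooth// EFinD -std_tail_setC.
set E := _ @^-1` _; have mE : measurable (~` E).
  by apply: measurableC; exact: measurable_enlargement.
rewrite -[~` E]setIT -integral_indic//.
rewrite -[X in (_ <= X + _)%E](integral_probability_cst std).
rewrite -ge0_integralD//; last first.
  by apply/measurable_EFinP; exact: measurable_indic.
apply: ge0_le_integral => //.
- apply/measurable_EFinP; apply: (ubm_comp uf) => i.
  under eq_fun do rewrite !mxE.
  by apply: measurable_funD => //; apply: measurable_funM => //; exact: measurable_tnth.
- apply: emeasurable_funD => //.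
  by apply/measurable_EFinP; exact: measurable_indic.
move=> t _; rewrite -EFinD lee_fin.
case: (boolP (t \in ~` E)) => tE.
  rewrite [X in _ <= _ + X]indicE tE; apply: (@le_trans _ _ 1).
    by have /andP[] := uf.2 (y + sigma *: col_of_tuple t).
  by rewrite lerDr indicE ler0n.
rewrite [X in _ <= _ + X]indicE (negbTE tE) addr0 !indicE.
case: (boolP (_ \in enlargement A r)) => [|_]; last by rewrite ler0n.
rewrite inE => yt; rewrite mem_set//.
apply: (enlargement_enlargement yt); rewrite opprD addNKr enormN.
by apply: shift_lt; move: tE; rewrite notin_setE => /contrapT.
Qed.

End sandwich.
End indicators.

(** * Comparison with the normal law on one Borel set *)

Section clt.
Context {R : realType} {m n : nat}.
Context d (W : measurableType d) (P : probability W R) (Y : 'I_n -> {mfun W >-> R}).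
Local Notation V := 'cV[R]_m.
Local Notation law i := (distribution P (Y i)).

Lemma lindeberg_error_ge0 d' (T : measurableType d') (Q : probability T R)
    (X : T -> R) (v r : R) : 0 <= lindeberg_error Q X v r.
Proof.
rewrite mulr_ge0 ?smooth_const_ge0// addr_ge0//;
  by apply: Rintegral_ge0 => t _; exact: psi_ge0.
Qed.

(** The alternative [a i = 0] admits units outside the subsample, for which no moment is controlled.
    One tail term is paid for passing from the indicator of [A] to the smoothed function, the other
    for returning to the indicator of the larger enlargement. *)
Lemma clt_borel (X : 'I_n -> R -> R) (a : 'I_n -> V) (v : 'I_n -> R) (sigma r : R)
    (A : set V) :
  mutually_independent P (fun i => Y i : W -> R) ->
  (forall i, measurable_fun setT (X i)) ->
  (forall i, a i = 0 \/ [/\ (law i).-integrable setT (EFin \o (fun y => X i y ^+ 2)),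
     \int[law i]_y X i y = 0 & \int[law i]_y (X i y ^+ 2) = v i]) ->
  (forall j k, \sum_i v i * (a i j 0 * a i k 0) = (j == k)%:R) ->
  0 < sigma -> <<s @open V >> A ->
  (P [set o | A (\sum_(i < n) X i (Y i o) *: a i)%R] <=
   std_normal (enlargement A (r + r)) +
     (@std_tail R m (r / sigma) + @std_tail R m (r / sigma) +
      \sum_(i < n) lindeberg_error (law i) (X i) (v i) (enorm (a i) / sigma))%:E)%E.
Proof.
move=> indY mX H covE s0 bA.
pose f : V -> R := \1_(enlargement A r).
have uf : ubm f by apply: ubm_indic; exact: measurable_enlargement.
have uS := gsmooth_ubm sigma uf.
set tail := @std_tail R m (r / sigma).
have tail0 : 0 <= tail by exact: std_tail_ge0.
have mT : cmeasurable (fun o => 0 + \sum_(i < n) X i (Y i o) *: a i).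
  move=> j; have -> : (fun o => (0 + \sum_(i < n) X i (Y i o) *: a i) j 0) =
      (fun o => \sum_(i < n) X i (Y i o) * a i j 0).
    by apply/funext => o; rewrite add0r summxE; apply: eq_bigr => i _; rewrite mxE.
  apply: measurable_sum => i; apply: measurable_funM => //.
  exact: measurableT_comp.
pose TA := [set o | A (0 + \sum_(i < n) X i (Y i o) *: a i)].
have mTA : measurable TA.
  exact: (cmeasurable_comp (f := id) mT (measurable_borel bA)).
have -> : [set o | A (\sum_(i < n) X i (Y i o) *: a i)] = TA.
  by apply/seteqP; split => o; rewrite /TA /= add0r.
have mST := ubm_comp uS mT.
have S01 := uS.2.
have step1 : (P TA <= (avgs (fun i => law i) X a (enum 'I_n) (gsmooth sigma f) 0 + tail)%:E)%E.
  rewrite EFinD -(integral_independent indY _ _ mX uS) -[TA]setIT -integral_indic//.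
  rewrite -[X in (_ <= _ + X)%E](integral_probability_cst P) -ge0_integralD//; last 2 first.
  - by move=> o _; rewrite lee_fin; have /andP[] := S01 (0 + \sum_(i < n) X i (Y i o) *: a i).
  - exact/measurable_EFinP.
  apply: ge0_le_integral => //.
  - by apply/measurable_EFinP; exact: measurable_indic.
  - by apply: emeasurable_funD => //; exact/measurable_EFinP.
  move=> o _; rewrite -EFinD lee_fin indicE.
  have /andP[S0 S1] := S01 (0 + \sum_(i < n) X i (Y i o) *: a i).
  case: (boolP (o \in TA)) => [|_]; last by rewrite addr_ge0.
  by rewrite inE => /(gsmooth_indic_ge r s0); rewrite lerBlDr.
have step2 : avgs (fun i => law i) X a (enum 'I_n) (gsmooth sigma f) 0 <=
    gsmooth 1 (gsmooth sigma f) 0 +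
    \sum_(i < n) lindeberg_error (law i) (X i) (v i) (enorm (a i) / sigma).
  (* By [covE] the Gaussian replacements have identity covariance, so their joint average is the
     standard one whatever the vectors [a i] are. *)
  have <- : navgs [seq Num.sqrt (v i) *: a i | i <- enum 'I_n] (gsmooth sigma f) =
      gsmooth 1 (gsmooth sigma f).
    apply: navgs_canonical => //.
    move=> j k; rewrite /cov big_map big_enum /= expr1n mul1r -covE.
    apply: eq_bigr => i _; rewrite !mxE.
    have [->|[_ _ Xv]] := H i; first by rewrite !mxE !mulr0.
    rewrite mulrACA -expr2 sqr_sqrtr// -Xv.
    by apply: Rintegral_ge0 => y _; exact: sqr_ge0.
  rewrite -lerBlDl -[X in _ <= X]big_enum.
  apply: (le_trans (ler_norm _)); apply: lindeberg_telescoping => // i g x _ ug.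
  have [a0|[iX2 X0 Xv]] := H i; last exact: lindeberg_step.
  rewrite a0 scaler0 navg0 avg0 subrr normr0.
  exact: lindeberg_error_ge0.
have step3 : ((gsmooth 1 (gsmooth sigma f) 0)%:E <=
    std_normal (enlargement A (r + r)) + tail%:E)%E.
  rewrite -integral_std_normal_gsmooth//.
  have mE : measurable (@col_of_tuple R m @^-1` enlargement A (r + r)).
    exact: measurable_enlargement.
  have -> : std_normal (enlargement A (r + r)) =
    (\int[std_normal_tuple R m]_t (\1_(@col_of_tuple R m @^-1` enlargement A (r + r)) t)%:E)%E.
    by rewrite integral_indic// setIT.
  rewrite -[X in (_ <= _ + X)%E](integral_probability_cst (std_normal_tuple R m)).
  rewrite -ge0_integralD//; last first.
    by apply/measurable_EFinP; exact: measurable_indic.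
  apply: ge0_le_integral => //.
  - by move=> t _; rewrite lee_fin; have /andP[] := S01 (0 + 1 *: col_of_tuple t).
  - apply/measurable_EFinP; apply: (ubm_comp uS) => i.
    under eq_fun do rewrite !mxE.
    by apply: measurable_funD => //; apply: measurable_funM => //; exact: measurable_tnth.
  - by apply: emeasurable_funD => //; apply/measurable_EFinP; exact: measurable_indic.
  move=> t _; rewrite -EFinD lee_fin add0r scale1r.
  by rewrite (le_trans (gsmooth_indic_le A r s0 _))// lerD2r !indicE.
apply: (le_trans step1).
have {}step2 : avgs (fun i => law i) X a (enum 'I_n) (gsmooth sigma f) 0 + tail <=
  gsmooth 1 (gsmooth sigma f) 0 + (tail +
    \sum_(i < n) lindeberg_error (law i) (X i) (v i) (enorm (a i) / sigma)).
  by apply: (le_trans (lerD step2 (lexx tail))); rewrite -addrA [X in _ + X]addrC.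
rewrite -lee_fin in step2; apply: (le_trans step2).
rewrite -(addrA tail) [X in (_ <= _ + X)%E]EFinD addeA [X in (X <= _)%E]EFinD.
exact: leeD2r.
Qed.

End clt.

(** * Symmetric matrices *)

Section symmetric_spectrum.
Context {R : realType}.

(* The spectral theorem is used over R[i]; the eigenvalues turn out to be real. *)
Lemma symmetric_poly_annihilate (n : nat) (A : 'M[R]_n.+1) : A^T = A ->
  exists2 ds : seq R, {in ds, forall d, eigenvalue A d} &
    forall q : {poly R}, {in ds, forall d, root q d} -> horner_mx A q = 0.
Proof.
move=> sA; pose toC := real_complex R.
pose AC := map_mx toC A.
have realC : AC \is a mxOver Num.real.
  by apply/mxOverP => i j; rewrite mxE; apply/complex_realP; exists (A i j).
have symC : AC \is symmetricmx.
  apply/is_hermitianmxP; rewrite expr0 scale1r.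
  by apply/matrixP => i j; rewrite !mxE -[in LHS]sA mxE.
have hermC := realsym_hermsym symC realC.
have /orthomx_spectralP := hermitian_normalmx hermC.
set U := spectralmx AC; set sp := spectral_diag AC => EA.
have uU : U \in unitmx by exact: spectral_unit.
have /mxOverP spR := hermitian_spectral_diag_real hermC.
pose d i := complex.Re (sp 0 i).
have dE i : toC (d i) = sp 0 i by exact: RRe_real (spR 0 i).
exists [seq d i | i <- enum 'I_n.+1].
  move=> _ /mapP[i _ ->].
  (* Being an eigenvalue is unaffected by the field extension, so a complex eigenvector, here a row
     of [U], is enough. *)
  rewrite -(eigenvalue_map toC) [X in eigenvalue _ X](dE i); apply/eigenvalueP.
  exists (delta_mx 0 i *m U).
    rewrite scalemxAl -/AC {1}EA -!mulmxA (mulmxA U) mulmxV// mul1mx mulmxA; congr (_ *m _).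
    apply/matrixP => k j; rewrite ord1 mul_mx_diag !mxE eqxx /=.
    by case: eqVneq => [->|]; rewrite ?mul1r ?mulr1// mul0r mulr0.
  apply/eqP => /(congr1 (mulmx^~ (invmx U))); rewrite mulmxK// mul0mx.
  move=> /matrixP/(_ 0 i)/eqP; rewrite !mxE !eqxx /=; exact/negP/oner_neq0.
move=> q qd; apply: (map_mx_inj (f := toC)); rewrite map_horner_mx -/AC {1}EA.
rewrite horner_mx_uconjC// horner_mx_diag.
have -> : map_mx (horner (map_poly toC q)) sp = 0.
  apply/matrixP => k i; rewrite ord1 !mxE -dE horner_map /=.
  by have /rootP -> := qd (d i) (map_f _ (mem_enum _ i)); rewrite rmorph0.
by rewrite map_mx0 [diag_mx _](_ : _ = 0) ?mulmx0 ?mul0mx//;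
  apply/matrixP => i j; rewrite !mxE mul0rn.
Qed.

Lemma poly_interpolation (ds : seq R) (g : R -> R) : uniq ds ->
  exists q : {poly R}, {in ds, forall d, q.[d] = g d}.
Proof.
elim: ds => [|e ds IH] /=; first by move=> _; exists 0.
move=> /andP[eds /IH[q qE]].
pose z := \prod_(d <- ds) ('X - d%:P).
have z0 : z.[e] != 0 by rewrite -[_ == _]/(root z e) root_prod_XsubC.
exists (q + ((g e - q.[e]) / z.[e]) *: z) => d; rewrite inE => /orP[/eqP ->|dds].
  by rewrite hornerD hornerZ divfK// addrC subrK.
have /rootP zd : root z d by rewrite root_prod_XsubC.
by rewrite hornerD hornerZ zd mulr0 addr0 qE.
Qed.

Lemma trmx_horner_mx (n : nat) (A : 'M[R]_n.+1) (q : {poly R}) :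
  A^T = A -> (horner_mx A q)^T = horner_mx A q.
Proof.
move=> sA; elim/poly_ind: q => [|q c IH]; first by rewrite rmorph0 trmx0.
rewrite rmorphD rmorphM /= horner_mx_X horner_mx_C raddfD /= tr_scalar_mx.
congr (_ + _); rewrite trmx_mul sA IH.
exact: (comm_mx_horner q (erefl (A *m A))).
Qed.

(* With g a root of some order, this realizes the functional calculus g(A) by an
   interpolation polynomial. *)
Lemma symmetric_horner_eq (n : nat) (A : 'M[R]_n.+1) (g : R -> R) : A^T = A ->
  exists2 q : {poly R}, (forall p : {poly R},
    (forall d, eigenvalue A d -> p.[g d] = d) -> horner_mx A (p \Po q) = A)
    & (horner_mx A q)^T = horner_mx A q.
Proof.
move=> sA; have [ds dsA dsq] := symmetric_poly_annihilate sA.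
have [q qE] := poly_interpolation g (undup_uniq ds).
exists q => [p pE|]; last exact: trmx_horner_mx.
apply/eqP; rewrite -subr_eq0 -[X in _ - X]horner_mx_X -rmorphB; apply/eqP.
apply: dsq => d dds; apply/rootP; rewrite !hornerE horner_comp qE ?mem_undup//.
by rewrite pE ?subrr//; exact: dsA.
Qed.

Lemma qform1 (n : nat) (x : 'cV[R]_n) : (x^T *m x) 0 0 = enorm x ^+ 2.
Proof. by rewrite enorm_sqr mxE; apply: eq_bigr => i _; rewrite mxE expr2. Qed.

Lemma psd_sqr (n : nat) (B : 'M[R]_n) : B^T = B -> psd (B *m B).
Proof.
move=> sB; split; first by rewrite trmx_mul sB.
move=> v; rewrite mulmxA -mulmxA -{1}sB -trmx_mul qform1.
exact: sqr_ge0.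
Qed.

(** A fourth root is taken as a symmetric polynomial in [A]; its square is a square root of [A] and,
    being the square of a symmetric matrix, is positive semi-definite without further spectral
    argument. *)
Lemma psd_sqrt_exists (n : nat) (A : 'M[R]_n.+1) : A^T = A ->
  (forall d, eigenvalue A d -> 0 <= d) -> exists B, psd B /\ B *m B = A.
Proof.
move=> sA A0.
have [q qE sq] := symmetric_horner_eq (fun d => Num.sqrt (Num.sqrt d)) sA.
exists (horner_mx A q *m horner_mx A q); split; first exact: psd_sqr.
have E : horner_mx A ('X^4 \Po q) = A.
  apply: qE => d dA; rewrite hornerXn (exprM _ 2 2) sqr_sqrtr ?sqrtr_ge0//.
  by rewrite sqr_sqrtr ?A0.
by rewrite -[RHS]E comp_Xn_poly rmorphXn /= !mulmxE -!expr2 -exprM.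
Qed.

(** [A - l%:M] is the square of a symmetric matrix, so its quadratic form is nonnegative. *)
Lemma qform_ge_eigenvalues (n : nat) (A : 'M[R]_n.+1) (l : R) : A^T = A ->
  (forall d, eigenvalue A d -> l <= d) ->
  forall x, l * enorm x ^+ 2 <= (x^T *m A *m x) 0 0.
Proof.
move=> sA Al x.
have [q qE sq] := symmetric_horner_eq (fun d => Num.sqrt (d - l)) sA.
have E : horner_mx A (('X^2 + l%:P) \Po q) = A.
  apply: qE => d dA; rewrite !hornerE sqr_sqrtr ?subrK//.
  by rewrite subr_ge0 Al.
have EA : A = horner_mx A q *m horner_mx A q + l%:M.
  rewrite -[LHS]E comp_polyD comp_Xn_poly comp_polyC rmorphD rmorphXn /= horner_mx_C.
  by rewrite expr2 mulmxE.
have := (psd_sqr sq).2 x; move: (horner_mx A q) EA => H -> H0.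
have S : (x^T *m l%:M *m x) 0 0 = l * enorm x ^+ 2.
  by rewrite scalar_mxC mul_scalar_mx -scalemxAl [LHS]mxE qform1.
by rewrite mulmxDr mulmxDl [leRHS]mxE S lerDr.
Qed.

(* The hypothesis 0 < l excludes the junk value 0 that inf takes on sets without
   an infimum. *)
Lemma lambda_min_eigenvalue (n : nat) (A : 'M[R]_n) (l : R) : 0 < l ->
  l <= lambda_min A -> forall d, eigenvalue A d -> l <= d.
Proof.
move=> l0 lA d dA; apply: (le_trans lA).
have [[_ hlb]|ninf] := pselect (has_inf [set a | eigenvalue A a]); first exact: ge_inf hlb _ dA.
by move: lA; rewrite /lambda_min inf_out// leNgt l0.
Qed.

Lemma unitmx_of_qform (n : nat) (A : 'M[R]_n) (l : R) : 0 < l ->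
  (forall x, l * enorm x ^+ 2 <= (x^T *m A *m x) 0 0) -> A \in unitmx.
Proof.
move=> l0 H; rewrite -row_free_unit -kermx_eq0; apply/rowV0P => v /sub_kermxP vA.
have := H v^T; rewrite trmxK vA mul0mx mxE pmulr_rle0// => v2.
have : enorm v^T ^+ 2 == 0 by rewrite eq_le v2 sqr_ge0.
by rewrite sqrf_eq0 enorm_eq0 => /eqP/(congr1 trmx); rewrite trmxK trmx0.
Qed.

End symmetric_spectrum.

(** * The studentizing matrix *)

Section studentization.
Context {R : realType} {n : nat}.
Variables (G D : 'M[R]_n.+1) (l : R).
Hypotheses (l_gt0 : 0 < l) (sG : G^T = G) (uG : G \in unitmx) (sD : D^T = D).
Hypothesis D_ge : forall x, l * enorm x ^+ 2 <= (x^T *m D *m x) 0 0.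

Local Notation Sg := (invmx G *m D *m invmx G).
Local Notation N := (invmx (sqrtmx Sg) *m invmx G).

(** Ensures that [xget] does not fall back on its default 0. For an eigenvector [v] of [Sg], the
    eigenvalue times the squared norm of [v] is the quadratic form of [D] at [invmx G *m v^T], hence
    nonnegative. *)
Lemma sqrtmx_sandwich : psd (sqrtmx Sg) /\ sqrtmx Sg *m sqrtmx Sg = Sg.
Proof.
have siG : (invmx G)^T = invmx G by rewrite trmx_inv sG.
have sS : Sg^T = Sg by rewrite !trmx_mul siG sD mulmxA.
have [B HB] : exists B, psd B /\ B *m B = Sg.
  apply: psd_sqrt_exists => // d /eigenvalueP[v vS v0].
  have v2 : 0 < enorm v^T ^+ 2.
    by rewrite exprn_gt0// lt_def enorm_ge0 enorm_eq0 trmx_eq0 v0.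
  have : 0 <= (v *m Sg *m v^T) 0 0.
    have := le_trans _ (D_ge (invmx G *m v^T)).
    rewrite trmx_mul trmxK siG !mulmxA; apply.
    by rewrite mulr_ge0 ?sqr_ge0// ltW.
  by rewrite vS -scalemxAl mxE -{1}(trmxK v) qform1 pmulr_lge0.
have := xgetPex 0 (ex_intro (fun B => psd B /\ B *m B = Sg) B HB).
by [].
Qed.

Let B := sqrtmx Sg.
Let uD : D \in unitmx := unitmx_of_qform l_gt0 D_ge.
Let uB : B \in unitmx.
Proof.
have [_ BB] := sqrtmx_sandwich.
have : B *m B \in unitmx by rewrite BB !unitmx_mul !unitmx_inv uG uD.
by rewrite unitmx_mul => /andP[].
Qed.
Let sB : B^T = B. Proof. by have [[]] := sqrtmx_sandwich. Qed.

Lemma studentize_cov : N *m D *m N^T = 1%:M.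
Proof.
have [_ BB] := sqrtmx_sandwich.
rewrite trmx_mul !trmx_inv sG -/B sB.
transitivity (invmx B *m (B *m B) *m invmx B); first by rewrite BB !mulmxA.
by rewrite mulmxA (mulVmx uB) mul1mx (mulmxV uB).
Qed.

(* With x = N^T N z one has D x = z, so |N z|^2 = x^T D x >= l |x|^2, while
   x^T D x = x.z <= |x| |z|. *)
Lemma studentize_norm (z : 'cV[R]_n.+1) : enorm (N *m z) ^+ 2 <= enorm z ^+ 2 / l.
Proof.
set x := N^T *m (N *m z).
have Dx : D *m x = z.
  have := studentize_cov; rewrite -mulmxA => /mulmx1C.
  by rewrite /x !mulmxA => ->; rewrite mul1mx.
have E : enorm (N *m z) ^+ 2 = (x^T *m D *m x) 0 0.
  by rewrite -qform1 -[in RHS]mulmxA Dx /x !trmx_mul !trmxK !mulmxA.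
have Ezx : enorm (N *m z) ^+ 2 = \sum_i x i 0 * z i 0.
  by rewrite E -mulmxA Dx mxE; apply: eq_bigr => i _; rewrite mxE.
have := D_ge x; rewrite -E; set s := enorm (N *m z) ^+ 2 => ls.
have s0 : 0 <= s by exact: sqr_ge0.
have sz : s <= enorm x * enorm z by rewrite /s Ezx; exact: dot_le_enorm.
have [->|sn0] := eqVneq s 0; first by rewrite divr_ge0 ?sqr_ge0// ltW.
have sp : 0 < s by rewrite lt_def sn0.
rewrite ler_pdivlMr// -(ler_pM2l sp).
apply: (@le_trans _ _ (l * (enorm x * enorm z) ^+ 2)).
  have -> : s * (s * l) = l * s ^+ 2 by ring.
  rewrite (ler_pM2l l_gt0) ler_sqr// nnegrE.
  by rewrite mulr_ge0 ?enorm_ge0.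
by rewrite exprMn mulrA ler_wpM2r ?sqr_ge0.
Qed.
End studentization.

(** * Bounds on the replacement error *)

Section moment_bounds.
Context {R : realType}.
Local Notation Rm := (measurableTypeR R).
Local Notation gam := (normal_prob (0 : R) 1).

(** Truncation at |t| = [eta]: below it the minimum is at most [eta], above it the minimum is at
    most 1 and the power is at least 1. No upper bound on [delta] is involved. *)
Lemma psi_le (delta eta t : R) : 0 < delta -> 0 < eta ->
  psi t <= eta * t ^+ 2 + t ^+ 2 * (`|t| / eta) `^ delta.
Proof.
move=> d0 e0; rewrite /psi mulrC -[X in _ <= _ + X]mulrC -mulrDl ler_wpM2r ?sqr_ge0//.
have [te|te] := leP `|t| eta.
  by rewrite ler_wpDr ?powR_ge0// ge_min te orbT.
rewrite ler_wpDl ?(ltW e0)// ge_min; apply/orP; left.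
rewrite -[X in X <= _](powRr0 (`|t| / eta)); apply: ler_powR; last exact: ltW.
by rewrite ler_pdivlMr// mul1r ltW.
Qed.

Lemma sqr_powR (delta t : R) : 0 < delta -> 0 <= t -> t `^ (2 + delta) = t ^+ 2 * t `^ delta.
Proof.
move=> d0 t0; rewrite powRD -?powR_mulrn//.
by rewrite (gt_eqF (addr_gt0 _ d0)).
Qed.

Section one_variable.
Context d (T : measurableType d) (P : probability T R) (X : T -> R) (e delta C : R).
Hypotheses (mX : measurable_fun setT X) (e1 : 1 <= e) (delta_gt0 : 0 < delta).
Hypothesis bound : (\int[P]_o ((`|X o| * e) `^ (2 + delta))%:E <= C%:E)%E.

Let U o := `|X o| * e.
Let U0 o : 0 <= U o. Proof. by rewrite mulr_ge0// (le_trans ler01). Qed.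
Let mU : measurable_fun setT U.
Proof. by apply: measurable_funM => //; exact: measurableT_comp. Qed.

Lemma integrable_moment : P.-integrable setT (EFin \o (fun o => U o `^ (2 + delta))).
Proof.
apply/integrableP; split.
  apply/measurable_EFinP; exact: (measurableT_comp (measurable_powR _)).
apply: le_lt_trans (ltry C); apply: le_trans bound.
by under eq_integral => o _ do rewrite /= ger0_norm ?powR_ge0//.
Qed.

Lemma sqr_le_moment (t : R) : 0 <= t -> t ^+ 2 <= 1 + t `^ (2 + delta).
Proof.
move=> t0; have [t1|t1] := leP t 1.
  by rewrite ler_wpDr ?powR_ge0// exprn_ile1.
rewrite ler_wpDl// -powR_mulrn//; apply: ler_powR; first exact: ltW.
by rewrite lerDl ltW.
Qed.

Let i1 : P.-integrable setT (EFin \o (cst 1 : T -> R)).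
Proof. exact: finite_measure_integrable_cst. Qed.

Let iU2 : P.-integrable setT (EFin \o (fun o => 1 + U o `^ (2 + delta))).
Proof. by apply: eq_integrable (integrableD measurableT i1 integrable_moment) => // o _. Qed.

Lemma moment_integrable_sqr : P.-integrable setT (EFin \o (fun o => X o ^+ 2)).
Proof.
apply: (le_integrable measurableT _ _ iU2) => [|o _].
  by apply/measurable_EFinP; exact: measurable_funX.
rewrite /= lee_fin [leRHS]ger0_norm ?addr_ge0 ?powR_ge0//.
rewrite ger0_norm ?sqr_ge0// (le_trans _ (sqr_le_moment (U0 o)))//.
by rewrite exprMn real_normK ?num_real// ler_peMr ?sqr_ge0// exprn_ege1.
Qed.

(** The factor [e ^+ 2] is kept because [rho] will be bounded by [kappa * e] only; together they
    bound [Num.sqrt v * rho] by a multiple of [kappa]. *)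
Lemma moment_variance : \int[P]_o (X o ^+ 2) * e ^+ 2 <= 1 + C.
Proof.
rewrite -RintegralZr//; last exact: moment_integrable_sqr.
have -> : 1 + C = \int[P]_o (1 : R) + C by rewrite Rintegral_probability_cst.
apply: (@le_trans _ _ (\int[P]_o (1 + U o `^ (2 + delta)))).
  apply: le_Rintegral => //.
    by apply: eq_integrable (integrableZr measurableT (e ^+ 2) moment_integrable_sqr) => // o _.
  move=> o _; apply: le_trans (sqr_le_moment (U0 o)).
  by rewrite exprMn real_normK ?num_real.
rewrite RintegralD//; last exact: integrable_moment.
rewrite lerD2l /Rintegral -lee_fin fineK//.
exact: (integrable_fin_num measurableT integrable_moment).
Qed.

Lemma moment_psi (rho kappa eta : R) : 0 <= rho -> rho <= kappa * e -> 0 < eta -> 0 <= kappa ->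
  \int[P]_o psi (X o * rho) <= eta * (\int[P]_o (X o ^+ 2) * rho ^+ 2)
     + kappa ^+ 2 * (kappa / eta) `^ delta * C.
Proof.
move=> r0 rk eta0 k0.
have eta0' := ltW eta0; have e0 : 0 <= e := le_trans ler01 e1.
set c := kappa ^+ 2 * (kappa / eta) `^ delta.
have c0 : 0 <= c by rewrite mulr_ge0 ?sqr_ge0 ?powR_ge0.
have iX2 := moment_integrable_sqr.
have j1 : P.-integrable setT (EFin \o (fun o => eta * rho ^+ 2 * X o ^+ 2)).
  by apply: eq_integrable (integrableZl measurableT (eta * rho ^+ 2) iX2) => // o _.
have j2 : P.-integrable setT (EFin \o (fun o => c * U o `^ (2 + delta))).
  by apply: eq_integrable (integrableZl measurableT c integrable_moment) => // o _.
apply: (@le_trans _ _ (\int[P]_o (eta * rho ^+ 2 * X o ^+ 2 + c * U o `^ (2 + delta)))).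
  apply: le_Rintegral => //.
  - exact: integrable_psi.
  - by apply: eq_integrable (integrableD measurableT j1 j2) => // o _.
  move=> o _; apply: (le_trans (psi_le (X o * rho) delta_gt0 eta0)); apply: lerD.
    by rewrite exprMn mulrA mulrAC.
  have tU : `|X o * rho| <= kappa * U o.
    by rewrite normrM (ger0_norm r0) /U mulrCA ler_wpM2l.
  have kU0 : 0 <= kappa * U o by rewrite mulr_ge0.
  rewrite sqr_powR// /c mulrACA -exprMn -powRM ?divr_ge0 ?(ltW eta0)//.
  apply: ler_pM; rewrite ?sqr_ge0 ?powR_ge0//.
    by rewrite -[leLHS]real_normK ?num_real// ler_sqr.
  apply: ge0_ler_powR; rewrite ?nnegrE ?divr_ge0 ?mulr_ge0 ?(ltW eta0) ?(ltW delta_gt0) ?invr_ge0//.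
  by rewrite mulrAC ler_wpM2r// invr_ge0 ltW.
rewrite RintegralD// RintegralZl// RintegralZl//; last exact: integrable_moment.
apply: lerD; first by rewrite -mulrA [_ ^+ 2 * _]mulrC.
rewrite ler_wpM2l// /Rintegral -lee_fin fineK//.
exact: (integrable_fin_num measurableT integrable_moment).
Qed.

End one_variable.

(** Here [psi] is bounded by the cube, as Gaussian third moments are finite; one factor
    [v * rho ^+ 2] is kept apart for the summation. *)
Lemma normal_psi (v rho : R) : 0 <= v -> 0 <= rho ->
  \int[gam]_y psi (Num.sqrt v * y * rho) <=
    v * rho ^+ 2 * (Num.sqrt v * rho) * \int[gam]_y gdom y.
Proof.
move=> v0 r0; set s := Num.sqrt v * rho.
have s0 : 0 <= s by rewrite mulr_ge0 ?sqrtr_ge0.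
have s2 : v * rho ^+ 2 = s ^+ 2 by rewrite exprMn sqr_sqrtr.
have ig := @integrable_gdom R.
have jg : gam.-integrable setT (EFin \o (fun y : Rm => s ^+ 3 * gdom y)).
  by apply: eq_integrable (integrableZl measurableT (s ^+ 3) ig) => // o _.
have pb (y : R) : psi (Num.sqrt v * y * rho) <= s ^+ 3 * gdom y.
  rewrite mulrAC -/s; apply: (@le_trans _ _ (`|s * y| ^+ 3)).
    rewrite /psi -(real_normK (num_real (s * y))) [leRHS]exprSr.
    by rewrite ler_wpM2l ?exprn_ge0// ge_min lexx orbT.
  rewrite normrM exprMn (ger0_norm s0) ler_wpM2l ?exprn_ge0//.
  exact: norm_exp_le_gdom.
rewrite s2 -exprSr -(RintegralZl _ measurableT ig); apply: le_Rintegral => //.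
apply: (@le_integrable _ Rm R gam setT measurableT _ _ _ _ jg) => [|y _].
  apply/measurable_EFinP; apply: (measurableT_comp measurable_psi).
  have := measurable_affine (Num.sqrt v * rho) 0.
  by congr measurable_fun; apply/funext => y; rewrite addr0 mulrAC.
rewrite /= lee_fin ger0_norm ?psi_ge0// (le_trans (pb y))//.
exact: ler_norm.
Qed.

(** Shaped for summation over the subsample: the terms [v * rho ^+ 2] add up to the dimension over
    sigma^2, and the factor [kappa ^+ 2], of order 1/|S|, compensates for the |S| copies of the
    moment bound. *)
Lemma lindeberg_error_le d (T : measurableType d) (P : probability T R) (X : T -> R)
    (e delta C rho kappa eta v : R) :
  measurable_fun setT X -> 1 <= e -> 0 < delta ->
  (\int[P]_o ((`|X o| * e) `^ (2 + delta))%:E <= C%:E)%E ->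
  0 <= rho -> rho <= kappa * e -> 0 < eta -> 0 <= kappa ->
  \int[P]_o (X o ^+ 2) = v ->
  lindeberg_error P X v rho <= @smooth_const R *
    ((eta + kappa * Num.sqrt (1 + C) * \int[gam]_y gdom y) * (v * rho ^+ 2)
     + kappa ^+ 2 * (kappa / eta) `^ delta * C).
Proof.
move=> mX e1 d0 bnd r0 rk eta0 k0 Ev.
have v0 : 0 <= v by rewrite -Ev; apply: Rintegral_ge0 => o _; exact: sqr_ge0.
have G0 : 0 <= \int[gam]_y gdom y.
  by apply: Rintegral_ge0 => x _; rewrite addr_ge0 ?expR_ge0.
rewrite ler_wpM2l ?smooth_const_ge0//.
apply: (le_trans (lerD (moment_psi mX e1 d0 bnd r0 rk eta0 k0) (normal_psi v0 r0))).
rewrite Ev mulrDl addrAC lerD2r lerD2l.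
have sr : Num.sqrt v * rho <= kappa * Num.sqrt (1 + C).
  apply: (@le_trans _ _ (kappa * (Num.sqrt v * e))).
    by rewrite mulrCA ler_wpM2l ?sqrtr_ge0.
  rewrite ler_wpM2l// -(@ger0_norm _ e) ?(le_trans ler01)// -sqrtr_sqr -sqrtrM//.
  by rewrite ler_wsqrtr// -Ev; exact: (moment_variance mX e1 d0 bnd).
by rewrite [leRHS]mulrC [leRHS]mulrA ler_wpM2r// ler_wpM2l// mulr_ge0 ?sqr_ge0.
Qed.

End moment_bounds.

(** * The studentized estimator *)

Section kernel_probability.
Context d d' (X : measurableType d) (Y : measurableType d') (R : realType).
Variables (k : R.-pker X ~> Y) (x : X).

Definition kernel_prob : set Y -> \bar R := k x.

HB.instance Definition _ := Measure.on kernel_prob.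

Let kernel_prob_setT : kernel_prob setT = 1%E. Proof. exact: prob_kernel. Qed.

HB.instance Definition _ := @Measure_isProbability.Build _ _ _ kernel_prob kernel_prob_setT.

End kernel_probability.

Lemma limn_einf_gt (R : realType) (u : nat -> R) (a b : R) : b < a ->
  (a%:E <= limn_einf (fun n => (u n)%:E))%E -> exists N, forall n, (N <= n)%N -> b < u n.
Proof.
move=> ba; rewrite limn_einf_lim (cvg_lim _ (@cvg_einfs_sup _ _))// => ab.
have : (b%:E < ereal_sup (range (einfs (fun n => (u n)%:E))))%E.
  by apply: lt_le_trans ab; rewrite lte_fin.
move=> /ereal_sup_gt[_ [N _ <-] bN]; exists N => n Nn.
rewrite -lte_fin; apply: (lt_le_trans bN); apply: ereal_inf_lbound.
by exists n.
Qed.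

Lemma mulmx_outer_conj (R : comPzRingType) (m : nat) (N : 'M[R]_m) (x : 'cV[R]_m) (b : R) :
  N *m (b *: (x *m x^T)) *m N^T = b *: ((N *m x) *m (N *m x)^T).
Proof. by rewrite -scalemxAr -scalemxAl trmx_mul !mulmxA. Qed.

Section finite_sample.
Context (R : realType) (p k n : nat).
Variables (M : sampling_model R p n) (s : p.-tuple R -> 'cV[R]_k)
  (w : covariates R p n) (S : {set 'I_n}).

Local Notation F := (sm_F M w).
Local Notation P := (kernel_prob (sm_cond M) w).
Local Notation law i := (distribution P (sm_Y M i)).
Local Notation G := (Gamma_mx s w S).
Local Notation D := (Delta_mx F s w S).
Local Notation B := (sqrtmx (Sigma_mx F s w S)).
Local Notation Z i := (regressor s (tnth w i)).
Local Notation c i := (cond_mean F (tnth w i)).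
Local Notation v i := (cond_var F (tnth w i)).

Lemma Gamma_sym : G^T = G.
Proof.
rewrite /Gamma_mx linearZ /= raddf_sum /=; congr (_ *: _).
by apply: eq_bigr => i _; rewrite trmx_mul trmxK.
Qed.

Lemma Delta_sym : D^T = D.
Proof.
rewrite /Delta_mx linearZ /= raddf_sum /=; congr (_ *: _).
by apply: eq_bigr => i _; rewrite linearZ /= trmx_mul trmxK.
Qed.

(** The intercept alone contributes 1. Hence a moment of ||ZU|| dominates the same moment of U. *)
Lemma enorm_regressor_ge1 i : 1 <= enorm (Z i).
Proof.
rewrite -(@ler_sqr _ 1) ?nnegrE ?enorm_ge0// expr1n enorm_sqr big_ord_recl.
rewrite (_ : ord0 = lshift (1 + k) (ord0 : 'I_1)); last exact: val_inj.
rewrite col_mxEu mxE expr1n lerDl.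
by apply: sumr_ge0 => j _; exact: sqr_ge0.
Qed.

Lemma integral_law i (f : R -> \bar R) :
  (\int[law i]_y f y = \int[F (tnth w i)]_y f y)%E.
Proof.
by apply: eq_measure_integral => A mA _; exact: sm_law.
Qed.

Lemma Rintegral_law i (f : R -> R) :
  \int[law i]_y f y = \int[F (tnth w i)]_y f y.
Proof. by rewrite /Rintegral integral_law. Qed.

(** Extended by 0 outside the subsample, so that sums run over all the independent outcomes of the
    sample. *)
Definition scores (i : 'I_n) : 'cV[R]_(1 + (1 + k)) :=
  if i \in S then (Num.sqrt #|S|%:R / #|S|%:R) *: (invmx B *m invmx G *m Z i) else 0.

Lemma studentizedE (y : 'I_n -> R) :
  studentized F s w S y = \sum_i (y i - c i) *: scores i.
Proof.
rewrite /studentized /theta_hat /theta_target -mulmxBr -scalerBr -sumrB.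
rewrite [RHS](bigID (mem S)) /= [X in _ = _ + X]big1 ?addr0; last first.
  by move=> i /negbTE iS; rewrite /scores iS scaler0.
have -> : \sum_(i in S) (y i - c i) *: scores i = \sum_(i in S)
    (Num.sqrt #|S|%:R / #|S|%:R) *: (invmx B *m invmx G *m ((y i - c i) *: Z i)).
  by apply: eq_bigr => i iS; rewrite /scores iS -scalemxAr !scalerA mulrC.
rewrite -scaler_sumr -mulmx_sumr -mulmxA -!scalemxAr scalerA; congr (_ *: (_ *m (_ *m _))).
by apply: eq_bigr => i _; rewrite scalerBl.
Qed.

Section bound.
Variables (l lG delta C : R).
Hypotheses (S_gt0 : (0 < #|S|)%N) (l_gt0 : 0 < l) (lG_gt0 : 0 < lG)
  (delta_gt0 : 0 < delta).
Hypotheses (G_ge : lG <= lambda_min G) (D_ge : l <= lambda_min D).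
Hypothesis moment : forall i, i \in S ->
  (cond_moment F s (2 + delta) (tnth w i) <= C%:E)%E.

Let uG : G \in unitmx.
Proof.
apply: (unitmx_of_qform lG_gt0); apply: qform_ge_eigenvalues; first exact: Gamma_sym.
exact: lambda_min_eigenvalue.
Qed.

Let D_qform x : l * enorm x ^+ 2 <= (x^T *m D *m x) 0 0.
Proof.
apply: qform_ge_eigenvalues; first exact: Delta_sym.
exact: lambda_min_eigenvalue.
Qed.

Let S_neq0 : #|S|%:R != 0 :> R.
Proof. by rewrite pnatr_eq0 -lt0n. Qed.

Let scale_sqr : (Num.sqrt #|S|%:R / #|S|%:R) ^+ 2 = #|S|%:R^-1 :> R.
Proof. by rewrite expr_div_n sqr_sqrtr// expr2 invfM mulrA mulfV// mul1r. Qed.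

Lemma scores_cov j j' : \sum_i v i * (scores i j 0 * scores i j' 0) = (j == j')%:R.
Proof.
have /matrixP/(_ j j') := studentize_cov l_gt0 Gamma_sym uG Delta_sym D_qform.
rewrite [RHS]mxE => <-; set N := _ *m invmx _.
rewrite (bigID (mem S)) /= [X in _ + X]big1 ?addr0; last first.
  by move=> i /negbTE iS; rewrite /scores iS !mxE !mulr0.
rewrite /Delta_mx -scalemxAr mulmx_sumr -scalemxAl mulmx_suml mxE summxE mulr_sumr.
apply: eq_bigr => i iS; rewrite /scores iS.
rewrite mulmx_outer_conj; set z := N *m Z i.
have -> : (v i *: (z *m z^T)) j j' = v i * (z j 0 * z j' 0).
  by rewrite mxE [(z *m z^T) j j']mxE big_ord1 [z^T 0 j']mxE.
rewrite [(_ *: z) j 0]mxE [(_ *: z) j' 0]mxE mulrACA -expr2 scale_sqr; ring.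
Qed.

(** Trace of [scores_cov]: the total variance does not grow with the subsample. *)
Lemma scores_variance : \sum_i v i * enorm (scores i) ^+ 2 = (1 + (1 + k))%:R.
Proof.
transitivity (\sum_(j < 1 + (1 + k)) \sum_i v i * (scores i j 0 * scores i j 0)).
  rewrite exchange_big /=; apply: eq_bigr => i _.
  by rewrite -mulr_sumr enorm_sqr; congr (_ * _); apply: eq_bigr => j _; rewrite expr2.
under eq_bigr => j _ do rewrite scores_cov eqxx.
by rewrite sumr_const card_ord.
Qed.

Lemma scores_norm i : i \in S ->
  enorm (scores i) <= (Num.sqrt (#|S|%:R * l))^-1 * enorm (Z i).
Proof.
move=> iS; rewrite -ler_sqr ?nnegrE ?mulr_ge0 ?invr_ge0 ?sqrtr_ge0 ?enorm_ge0//.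
rewrite /scores iS enormZ exprMn real_normK ?num_real// scale_sqr.
have E : (Num.sqrt (#|S|%:R * l))^-1 ^+ 2 = #|S|%:R^-1 / l.
  by rewrite exprVn sqr_sqrtr ?mulr_ge0 ?(ltW l_gt0)// invfM.
rewrite [leRHS]exprMn E -mulrA ler_wpM2l ?invr_ge0// [leRHS]mulrC.
exact: (studentize_norm l_gt0 Gamma_sym uG Delta_sym D_qform).
Qed.

Let X i (y : R) : R := y - c i.

Let mX i : measurable_fun setT (X i).
Proof. by apply: measurable_funB. Qed.

Let Xmoment i : i \in S ->
  (\int[law i]_y ((`|X i y| * enorm (Z i)) `^ (2 + delta))%:E <= C%:E)%E.
Proof.
move=> iS; rewrite integral_law; have := moment iS; rewrite /cond_moment.
by under eq_integral => y _ do rewrite enormZ.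
Qed.

Let Xsqr i : i \in S -> (law i).-integrable setT (EFin \o (fun y => X i y ^+ 2)).
Proof.
move=> iS.
exact: (moment_integrable_sqr (mX i) (enorm_regressor_ge1 i) delta_gt0 (Xmoment iS)).
Qed.

Let Xmean i : i \in S -> \int[law i]_y X i y = 0.
Proof.
move=> iS; have iX := integrable_of_sqr (mX i) (Xsqr iS).
have ic : (law i).-integrable setT (EFin \o (cst (c i) : R -> R)).
  exact: finite_measure_integrable_cst.
(* [cond_mean] is a genuine mean only if the outcome is integrable. This follows from the
   integrability of [y - c i], whatever the value of [c i]. *)
have iy : (law i).-integrable setT (EFin \o (id : R -> R)).
  by apply: eq_integrable (integrableD measurableT iX ic) => // y _; rewrite /= -EFinD /X subrK.
rewrite /X RintegralB// Rintegral_probability_cst Rintegral_law.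
by rewrite /cond_mean subrr.
Qed.

Let Xvar i : \int[law i]_y (X i y ^+ 2) = v i.
Proof. by rewrite Rintegral_law. Qed.

Variables (sigma eta r : R) (A : set 'cV[R]_(1 + (1 + k))).
Hypotheses (sigma_gt0 : 0 < sigma) (eta_gt0 : 0 < eta)
  (borelA : <<s @open 'cV[R]_(1 + (1 + k)) >> A).

Let kappa := (Num.sqrt (#|S|%:R * l))^-1 / sigma.
Let g3 := \int[normal_prob (0 : R) 1]_y gdom y.

(** The size of the subsample enters the error through [kappa] alone. *)
Lemma finite_sample_bound :
  (P [set o | A (studentized F s w S (fun i => sm_Y M i o))] <=
   std_normal (enlargement A (r + r)) +
   (@std_tail R (1 + (1 + k)) (r / sigma) + @std_tail R (1 + (1 + k)) (r / sigma) +
    @smooth_const R * ((eta + kappa * Num.sqrt (1 + C) * g3) * ((1 + (1 + k))%:R / sigma ^+ 2)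
      + (kappa / eta) `^ delta * (C / (l * sigma ^+ 2))))%:E)%E.
Proof.
have -> : [set o | A (studentized F s w S (fun i => sm_Y M i o))] =
    [set o | A (\sum_i X i (sm_Y M i o) *: scores i)].
  by apply/seteqP; split => o /=; rewrite studentizedE.
have H i : scores i = 0 \/ [/\ (law i).-integrable setT (EFin \o (fun y => X i y ^+ 2)),
     \int[law i]_y X i y = 0 & \int[law i]_y (X i y ^+ 2) = v i].
  have [iS|iS] := boolP (i \in S); last by left; rewrite /scores (negbTE iS).
  by right; split; [exact: Xsqr|exact: Xmean|exact: Xvar].
have indY : mutually_independent P (fun i => sm_Y M i : sm_space M -> R).
  exact: sm_independent.
apply: (le_trans (clt_borel r indY mX H scores_cov sigma_gt0 borelA)).
rewrite leeD2l// lee_fin lerD2l.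
have kappa0 : 0 <= kappa by rewrite divr_ge0 ?invr_ge0 ?sqrtr_ge0// ltW.
have sn0 : sigma != 0 by rewrite gt_eqF.
have ln0 : l != 0 by rewrite gt_eqF.
rewrite (bigID (mem S)) /= [X in _ + X]big1 ?addr0; last first.
  move=> i /negbTE iS; rewrite /scores iS.
  rewrite (_ : enorm _ = 0) ?mul0r; last by apply/eqP; rewrite enorm_eq0.
  have psi0 : psi 0 = 0 :> R by rewrite /psi expr0n mul0r.
  rewrite /lindeberg_error.
  under eq_Rintegral do rewrite mulr0 psi0.
  under [X in _ + X]eq_Rintegral do rewrite mulr0 psi0.
  by rewrite !Rintegral_cst// !mul0r addr0 mulr0.
pose rho i := enorm (scores i) / sigma.
apply: (@le_trans _ _ (\sum_(i in S) @smooth_const R *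
    ((eta + kappa * Num.sqrt (1 + C) * g3) * (v i * rho i ^+ 2)
     + kappa ^+ 2 * (kappa / eta) `^ delta * C))).
  apply: ler_sum => i iS.
  apply: (lindeberg_error_le (mX i) (enorm_regressor_ge1 i) delta_gt0 (Xmoment iS)) => //.
  - by rewrite divr_ge0 ?enorm_ge0// ltW.
  - rewrite /rho /kappa [leRHS]mulrAC ler_wpM2r ?invr_ge0 ?(ltW sigma_gt0)//.
    exact: scores_norm.
  - exact: Xvar.
rewrite -mulr_sumr ler_wpM2l ?smooth_const_ge0// big_split /= -mulr_sumr sumr_const.
apply: lerD.
  rewrite le_eqVlt; apply/orP; left; apply/eqP; congr (_ * _).
  rewrite -scores_variance mulr_suml [RHS](bigID (mem S)) /= [X in _ = _ + X]big1 ?addr0.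
    by apply: eq_bigr => i _; rewrite /rho expr_div_n mulrA.
  move=> i /negbTE iS; rewrite /scores iS (_ : enorm _ = 0) ?expr0n ?mulr0 ?mul0r//.
  by apply/eqP; rewrite enorm_eq0.
rewrite le_eqVlt; apply/orP; left; apply/eqP.
(* |S| times [kappa ^+ 2] does not depend on |S|, so the sum of the truncated parts keeps only the
   small power of [kappa]. *)
have -> : kappa ^+ 2 = (#|S|%:R * l * sigma ^+ 2)^-1.
  by rewrite /kappa expr_div_n exprVn sqr_sqrtr ?mulr_ge0 ?(ltW l_gt0)// [RHS]invfM.
rewrite -mulr_natr; field.
by rewrite S_neq0 ln0 sn0.
Qed.

End bound.
End finite_sample.

(** * From the finite sample bound to the limit *)

Lemma levy_prokhorov_le (R : realType) (m : nat) (P Q : set 'cV[R]_m -> \bar R) (e : R) :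
  0 < e -> (forall A, <<s @open 'cV[R]_m >> A -> (P A <= Q (enlargement A e) + e%:E)%E) ->
  `|levy_prokhorov P Q| <= e.
Proof.
move=> e0 H; rewrite /levy_prokhorov; set E := [set _ | _].
have lb0 : lbound E 0 by move=> x [x0 _]; exact: ltW.
have Ee : E e by split.
rewrite ger0_norm; first by apply: ge_inf => //; exists 0.
by apply: lb_le_inf => //; exists e.
Qed.

(** Each of the three terms gets a third of [e]. [eta] comes first, and [kappa0] depends on it
    through the ratio [kappa / eta]; the denominators [x + 1] cover vanishing coefficients. *)
Lemma error_small (R : realType) (a b c delta e : R) :
  0 <= a -> 0 <= b -> 0 <= c -> 0 < delta -> 0 < e ->
  exists eta, 0 < eta /\ exists2 kappa0, 0 < kappa0 & forall kappa, 0 <= kappa ->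
    kappa <= kappa0 -> a * (eta + kappa * c) + b * (kappa / eta) `^ delta <= e.
Proof.
move=> a0 b0 c0 d0 e0.
have small (x : R) : 0 <= x -> 0 < e / (3 * (x + 1)) /\ x * (e / (3 * (x + 1))) <= e / 3.
  move=> x0; have x1 : 0 < x + 1 by rewrite ltr_wpDl.
  split; first by rewrite divr_gt0// mulr_gt0.
  have -> : x * (e / (3 * (x + 1))) = e / 3 * (x / (x + 1)).
    by field; rewrite gt_eqF.
  by rewrite ler_piMr ?divr_ge0 ?(ltW e0)// ler_pdivrMr// mul1r lerDl.
have [eta0 etaE] := small a a0.
have [k10 k1E] := small (a * c) (mulr_ge0 a0 c0).
have [t0 tE] := small b b0.
set eta := e / _ in eta0 etaE; set k1 := e / _ in k10 k1E; set t := e / _ in t0 tE.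
exists eta; split => //; exists (Num.min k1 (eta * t `^ delta^-1)).
  by rewrite lt_min k10 mulr_gt0// powR_gt0.
move=> kappa kge; rewrite le_min => /andP[kk1 kk2].
have q : (kappa / eta) `^ delta <= t.
  have -> : t = (t `^ delta^-1) `^ delta by rewrite -powRrM mulVf ?gt_eqF// powRr1// ltW.
  have ke : 0 <= kappa / eta := divr_ge0 kge (ltW eta0).
  apply: ge0_ler_powR; rewrite ?nnegrE ?powR_ge0 ?(ltW d0)//.
  by rewrite ler_pdivrMr// mulrC.
have -> : e = e / 3 + e / 3 + e / 3 by field.
rewrite mulrDr; apply: lerD; first apply: lerD => //.
  by apply: le_trans k1E; rewrite [kappa * c]mulrC mulrA ler_wpM2l// mulr_ge0.
by apply: le_trans tE; rewrite ler_wpM2l.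
Qed.

Theorem proposition3 (R : realType) (p k : nat)
  (M : forall n : nat, sampling_model R p n)
  (Sstar : forall n : nat, covariates R p n -> {set 'I_n})
  (s : forall n : nat, covariates R p n -> p.-tuple R -> 'cV[R]_k)
  (w : forall n : nat, covariates R p n)
  (lambda_Gamma lambda_Delta delta : R) (C : bool -> R)
  (card_Sstar : (fun n : nat => #|Sstar n (w n)|) @ \oo --> \oo)
  (lambda_Gamma_gt0 : 0 < lambda_Gamma)
  (Gamma_liminf :
    (lambda_Gamma%:E <=
     limn_einf (fun n : nat =>
       (lambda_min (Gamma_mx (s n (w n)) (w n) (Sstar n (w n))))%:E))%E)
  (lambda_Delta_gt0 : 0 < lambda_Delta)
  (Delta_liminf :
    (lambda_Delta%:E <=
     limn_einf (fun n : nat =>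
       (lambda_min (Delta_mx (sm_F (M n) (w n)) (s n (w n)) (w n)
                             (Sstar n (w n))))%:E))%E)
  (delta_gt0 : 0 < delta)
  (moment_bounded : forall (n : nat) (d : bool) (x : p.-tuple R),
    subsample_covariates (w n) (Sstar n (w n)) d x ->
    (cond_moment (sm_F (M n) (w n)) (s n (w n)) (2 + delta) (x, d)
       <= (C d)%:E)%E) :
  (fun n : nat =>
     levy_prokhorov
       (cond_law (M n) (w n) (fun v : covariates R p n =>
          studentized (sm_F (M n) v) (s n v) v (Sstar n v)))
       (@std_normal R (1 + (1 + k)))) @ \oo --> (0 : R).
Proof.
apply/cvgrPdist_le => e e0.
(* The enlargement has radius [r + r = e]. The error budget [e] is split into [r] for the two tails
   and [r] for the replacement. *)
pose r := e / 2; have r0 : 0 < r by rewrite divr_gt0.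
have rr : r + r = e by rewrite -splitr.
have [rho rho0 tail_small] : exists2 rho : R, 0 < rho & @std_tail R (1 + (1 + k)) rho < r / 2.
  by apply: std_tail_small; rewrite divr_gt0.
(* Chosen so that [r / sigma] is the radius [rho] beyond which the normal tail is small. *)
pose sigma := r / rho; have sigma0 : 0 < sigma by rewrite divr_gt0.
have rs : r / sigma = rho by rewrite /sigma invf_div mulrCA mulfV ?mulr1// gt_eqF.
(* A lower limit yields eventual bounds only strictly below its value, hence the halves. *)
pose l := lambda_Delta / 2; have l0 : 0 < l by rewrite divr_gt0.
pose lG := lambda_Gamma / 2; have lG0 : 0 < lG by rewrite divr_gt0.
have [N1 HG] : exists N, forall n, (N <= n)%N ->
    lG < lambda_min (Gamma_mx (s n (w n)) (w n) (Sstar n (w n))).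
  by apply: limn_einf_gt Gamma_liminf; rewrite ltr_pdivrMr// ltr_pMr// ltr1n.
have [N2 HD] : exists N, forall n, (N <= n)%N ->
    l < lambda_min (Delta_mx (sm_F (M n) (w n)) (s n (w n)) (w n) (Sstar n (w n))).
  by apply: limn_einf_gt Delta_liminf; rewrite ltr_pdivrMr// ltr_pMr// ltr1n.
(* One bound for both treatment arms; the absolute values make it nonnegative. *)
pose K := `|C true| + `|C false|.
have K0 : 0 <= K by rewrite addr_ge0.
have CK d : C d <= K.
  rewrite /K (le_trans (ler_norm _))//.
  by case: d; [rewrite lerDl|rewrite lerDr].
have g30 : 0 <= \int[normal_prob (0 : R) 1]_y gdom y.
  by apply: Rintegral_ge0 => x _; rewrite addr_ge0 ?expR_ge0.
have SC0 := @smooth_const_ge0 R.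
have s20 : 0 < sigma ^+ 2 by rewrite exprn_gt0.
have a_ge0 : 0 <= @smooth_const R * ((1 + (1 + k))%:R / sigma ^+ 2).
  by apply: mulr_ge0 => //; apply: divr_ge0 => //; exact: ltW.
have b_ge0 : 0 <= @smooth_const R * (K / (l * sigma ^+ 2)).
  by apply: mulr_ge0 => //; apply: divr_ge0 => //; apply/ltW/mulr_gt0.
have c_ge0 : 0 <= Num.sqrt (1 + K) * \int[normal_prob (0 : R) 1]_y gdom y.
  by apply: mulr_ge0 => //; exact: sqrtr_ge0.
have [eta [eta0 [kappa0 kappa00 small]]] :=
  error_small a_ge0 b_ge0 c_ge0 delta_gt0 r0.
(* [kappa <= kappa0] amounts to |S| being at least the inverse of l (kappa0 sigma)^2; the successor
   also makes the subsample nonempty. *)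
pose m0 := (Num.bound (l * (kappa0 * sigma) ^+ 2)^-1).+1.
have ks0 : 0 < l * (kappa0 * sigma) ^+ 2 by rewrite mulr_gt0// exprn_gt0// mulr_gt0.
have [N3 _ HS] := (cvgnyPge _).1 card_Sstar m0.
exists (maxn N1 (maxn N2 N3)) => // n /=; rewrite !geq_max => /and3P[n1 n2 n3].
rewrite sub0r normrN; apply: levy_prokhorov_le => // A bA.
have mS : (m0 <= #|Sstar n (w n)|)%N by exact: HS.
have S0 : (0 < #|Sstar n (w n)|)%N by exact: leq_trans mS.
have moment i : i \in Sstar n (w n) ->
    (cond_moment (sm_F (M n) (w n)) (s n (w n)) (2 + delta) (tnth (w n) i) <= K%:E)%E.
  move=> iS; rewrite [tnth _ _]surjective_pairing.
  apply: (@le_trans _ _ (C (tnth (w n) i).2)%:E); last by rewrite lee_fin.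
  by apply: moment_bounded; exists i.
have := finite_sample_bound S0 l0 lG0 delta_gt0 (ltW (HG n n1)) (ltW (HD n n2))
  moment r sigma0 eta0 bA.
rewrite rr rs => /le_trans; apply; rewrite leeD2l// lee_fin.
set kappa := _^-1 / sigma.
have kappa_ge0 : 0 <= kappa by rewrite divr_ge0 ?invr_ge0 ?sqrtr_ge0 ?(ltW sigma0).
have kappa_le : kappa <= kappa0.
  have mS0 : 0 < #|Sstar n (w n)|%:R * l by rewrite mulr_gt0// ltr0n.
  have ksg : 0 < kappa0 * sigma by exact: mulr_gt0.
  rewrite ler_pdivrMr// -[leRHS]invrK lef_pV2 ?posrE ?invr_gt0 ?sqrtr_gt0//.
  have ki : 0 <= (kappa0 * sigma)^-1 by rewrite invr_ge0 ltW.
  rewrite -[leLHS](ger0_norm ki) -sqrtr_sqr ler_wsqrtr// exprVn.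
  have : (l * (kappa0 * sigma) ^+ 2)^-1 <= #|Sstar n (w n)|%:R.
    apply: (@le_trans _ _ m0%:R); last by rewrite ler_nat.
    apply: ltW; apply: (@lt_trans _ _ (Num.bound (l * (kappa0 * sigma) ^+ 2)^-1)%:R).
      by apply: archi_boundP; rewrite invr_ge0 ltW.
    by rewrite ltr_nat.
  rewrite invfM => H; rewrite -ler_pdivrMr//; by rewrite mulrC.
have H := small kappa kappa_ge0 kappa_le.
set err := smooth_const * _.
have Herr : err <= r.
  apply: le_trans H; rewrite le_eqVlt; apply/orP; left; apply/eqP.
  by rewrite /err mulrDr !mulrA !(mulrAC _ _ (eta + _)) -!mulrA; ring.
rewrite -[leRHS]rr; apply: lerD Herr.
by rewrite [leRHS]splitr; apply: lerD; exact: ltW.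
Qed.
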